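(* Let $p \in [1, \infty)$, let $G$ be a countable discrete group, and let $X$ be a free compact metrizable $G$-space. Let $E \colon F^p_{\mathrm r}(G, X) \to C(X)$ be the standard conditional expectation. For a $G$-invariant Borel probability measure $\mu$ on $X$, define a linear functional $\tau_\mu$ on $F^p_{\mathrm r}(G, X)$ by $\tau_\mu(a) = \int_X E(a)\, d\mu$ for all $a \in F^p_{\mathrm r}(G, X)$. Then $\mu \mapsto \tau_\mu$ is an affine bijection from the $G$-invariant Borel probability measures on $X$ to the normalized traces on $F^p_{\mathrm r}(G, X)$. Its inverse sends $\tau$ to the measure obtained from the functional $\tau|_{C(X)}$ via the Riesz Representation Theorem.
   Context: A $G$-space is a topological space with a continuous action of $G$; it is free if $gx\ne x$ for all $x$ and all $g\ne1$. A normalized trace on a unital Banach algebra $A$ is a linear functional $\tau$ with $\tau(1)=1$, $\|\tau\|=1$, and $\tau(ba)=\tau(ab)$ for all $a,b\in A$. $C(X)$ with the supremum norm carries the isometric action $\alpha_g(f)(x)=f(g^{-1}x)$ of $G$. A contractive representation $\pi_0\colon C(X)\to L(L^p(Y,\lambda))$ is a homomorphism with $\|\pi_0(f)\|\le\|f\|$; it is nondegenerate if the span of $\{\pi_0(f)\xi\}$ is dense, and $\sigma$-finite if $\lambda$ is $\sigma$-finite. The associated regular covariant representation $(v,\pi)$ acts on $l^p(G,L^p(Y,\lambda))$ by $(v_g\xi)(h)=\xi(g^{-1}h)$ and $(\pi(f)\xi)(h)=\pi_0(\alpha_h^{-1}(f))(\xi(h))$. $C_{\mathrm c}(G,C(X),\alpha)$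 is the algebra of finite sums $\sum_{g\in G} f_gu_g$ with $f_g\in C(X)$ and product determined by $(fu_g)(ku_h)=f\alpha_g(k)u_{gh}$, and $(v\ltimes\pi)(\sum_g f_gu_g)=\sum_g\pi(f_g)v_g$. The reduced $L^p$ operator crossed product $F^p_{\mathrm r}(G,X)=F^p_{\mathrm r}(G,C(X),\alpha)$ is the Hausdorff completion of $C_{\mathrm c}(G,C(X),\alpha)$ in the seminorm $a\mapsto\sup\|(v\ltimes\pi)(a)\|$, over all regular covariant representations $(v,\pi)$ coming from nondegenerate $\sigma$-finite contractive representations $\pi_0$ of $C(X)$ on $L^p$ spaces. $C(X)$ is identified with its (isometric) image under $f\mapsto fu_1$. The standard conditional expectation $E\colon F^p_{\mathrm r}(G,X)\to C(X)$ is the contractive linear map determined by $E(\sum_g f_gu_g)=f_1$. *)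

(* Defs.v *)
From HB Require Import structures.
From mathcomp Require Import all_boot all_order all_algebra.
From mathcomp Require Import generic_quotient ring_quotient.
From mathcomp Require Import all_classical all_reals all_analysis.
From mathcomp Require Import measurable_realfun complex.

Set Implicit Arguments.
Unset Strict Implicit.
Unset Printing Implicit Defensive.
Import Order.TTheory GRing.Theory Num.Theory.
Import numFieldNormedType.Exports.

Local Open Scope classical_set_scope.
Local Open Scope ring_scope.
Local Open Scope quotient_scope.

(* The topology and norm of R[i] are found by the library only through a
   numFieldType, hence the name. *)
Definition Cx (R : realType) : numClosedFieldType := R[i].

(* Norms on complex spaces take their (nonnegative real) values in the field of
   scalars Cx R; rnorm is the same norm with values in R. *)
Definition rnorm (R : realType) (V : normedZmodType (Cx R)) (x : V) : R :=
  complex.Re `|x|.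

Section rnorm_theory.
Context {R : realType} {V : normedZmodType (Cx R)}.
Implicit Types x y : V.

Lemma rnorm_ge0 x : 0 <= rnorm x.
Proof. by rewrite /rnorm; have := normr_ge0 x; rewrite lecE => /andP[]. Qed.

Lemma rnormE x : `|x| = real_complex R (rnorm x) :> Cx R.
Proof.
rewrite /rnorm; have := normr_ge0 x; rewrite lecE => /andP[/eqP/= + _].
by case: (`|x|) => a b /= ->.
Qed.

Lemma ler_rnormD x y : rnorm (x + y) <= rnorm x + rnorm y.
Proof. by have := ler_normD x y; rewrite !rnormE -rmorphD/= lecR. Qed.
End rnorm_theory.

Lemma rnormM (R : realType) (x y : Cx R) : rnorm (x * y) = rnorm x * rnorm y.
Proof. exact: Normc.normcM. Qed.

Definition opnorm (R : realType) (V W : Type) (nV : V -> \bar R)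
    (nW : W -> \bar R) (T : V -> W) : \bar R :=
  ereal_sup [set nW (T x) | x in [set x | (nV x <= 1)%E]].

(* The product is not the one of the GRing hierarchy because HB admits no join
   of GRing.NzRing and Num.NormedZmodule. *)
HB.mixin Record CompleteNormedModule_isBanachAlgebra (K : numFieldType) A
    of CompleteNormedModule K A := {
  bone : A ;
  bmul : A -> A -> A ;
  bmulA : associative bmul ;
  bmul1x : left_id bone bmul ;
  bmulx1 : right_id bone bmul ;
  bmul_linearl : forall y, linear (bmul^~ y) ;
  bmul_linearr : forall x, linear (bmul x) ;
  bmul_norm : forall x y, `|bmul x y| <= `|x| * `|y| }.
#[short(type="banachAlgType")]
HB.structure Definition BanachAlgebra (K : numFieldType) :=
  {A of CompleteNormedModule K A & CompleteNormedModule_isBanachAlgebra K A}.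

Section spaces.
Variables (G : groupType) (X : topologicalType).

(* G is discrete, so an action is continuous iff each group element acts
   continuously. *)
Record gspace := GSpace {
  act :> G -> X -> X ;
  act1 : forall x, act 1%g x = x ;
  actM : forall g h x, act (g * h)%g x = act g (act h x) ;
  act_continuous : forall g, continuous (act g) }.

Definition free_action (a : gspace) := forall g x, a g x = x -> g = 1%g.

Definition metrizable (R : realType) := exists d : X -> X -> R,
  [/\ forall x y, 0 <= d x y,
      forall x y, d x y = 0 <-> x = y,
      forall x y, d x y = d y x,
      forall x y z, d x z <= d x y + d y z &
      forall x (B : set X),
        nbhs x B <-> exists2 e, 0 < e & [set y | d x y < e] `<=` B].
End spaces.

Section continuous_functions.
Variables (R : realType) (X : topologicalType).
Local Notation C := (Cx R).

Definition cont_pred : {pred X -> C} := mem [set f : X -> C | continuous f].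

Lemma cont_predP (f : X -> C) : reflect (continuous f) (f \in cont_pred).
Proof. by apply: (iffP idP) => [/set_mem//|?]; apply: mem_set. Qed.

Lemma cont_subring : subring_closed cont_pred.
Proof.
split.
- by apply/cont_predP => x; exact: cvg_cst.
- move=> f g /cont_predP cf /cont_predP cg; apply/cont_predP => x.
  by apply: cvgB; [exact: cf|exact: cg].
- move=> f g /cont_predP cf /cont_predP cg; apply/cont_predP => x.
  by apply: cvgM; [exact: cf|exact: cg].
Qed.
HB.instance Definition _ :=
  GRing.isSubringClosed.Build (X -> C) cont_pred cont_subring.

Lemma cont_scale : scaler_closed cont_pred.
Proof.
move=> c f /cont_predP cf; apply/cont_predP => x.
by apply: cvgM; [exact: cvg_cst|exact: cf].
Qed.
HB.instance Definition _ :=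
  GRing.isScaleClosed.Build C (X -> C) cont_pred cont_scale.

Record contfun :=
  ContFun { contfun_fun :> X -> C ; contfunP : contfun_fun \in cont_pred }.
HB.instance Definition _ := [isSub for contfun_fun].
HB.instance Definition _ := [Choice of contfun by <:].
HB.instance Definition _ := [SubChoice_isSubZmodule of contfun by <:].
HB.instance Definition _ := GRing.SubZmodule_isSubPzRing.Build
  (X -> C) cont_pred contfun (subringClosedP _).
HB.instance Definition _ := GRing.SubPzRing_isSubComPzRing.Build
  (X -> C) cont_pred contfun.
HB.instance Definition _ := [SubZmodule_isSubLmodule of contfun by <:].

(* For compact X; the real supremum of the empty set is 0, so that this is
   also the norm of the zero algebra when X is empty. *)
Definition supnorm (f : contfun) : R := sup [set rnorm (f x) | x in [set: X]].

End continuous_functions.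

Section Lp_functions.
Context d (Y : measurableType d) (R : realType).
Variables (lambda : {measure set Y -> \bar R}) (p : R).
Local Notation C := (Cx R).

Definition cmeasurable (f : Y -> C) :=
  measurable_fun setT (fun y => complex.Re (f y)) /\
  measurable_fun setT (fun y => complex.Im (f y)).

Definition Lp_pred of 1 <= p : {pred Y -> C} := mem [set f : Y -> C |
  cmeasurable f /\ (fun y => rnorm (f y)) \in Lfun lambda p%:E].

Hypothesis p1 : 1 <= p.

Lemma Lp_predP f :
  reflect (cmeasurable f /\ (fun y => rnorm (f y)) \in Lfun lambda p%:E)
          (f \in Lp_pred p1).
Proof. by apply: (iffP idP) => [/set_mem//|?]; apply: mem_set. Qed.

Lemma measurable_rnorm f :
  cmeasurable f -> measurable_fun setT (fun y => rnorm (f y)).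
Proof.
move=> [mr mi].
rewrite (_ : (fun y => _) = (fun y =>
    Num.sqrt (complex.Re (f y) ^+ 2 + complex.Im (f y) ^+ 2))); last first.
  by apply/funext => y; rewrite /rnorm normc_def.
apply: measurableT_comp.
  by apply: continuous_measurable_fun; exact: sqrt_continuous.
by apply: measurable_funD; apply: measurable_funX.
Qed.

Lemma measurable_powp (h : Y -> R) : measurable_fun setT h ->
  measurable_fun setT (fun y => `|(h y)%:E| `^ p)%E.
Proof.
move=> mh; apply: (@measurableT_comp _ _ _ _ _ _ (@poweR R ^~ p)).
  exact: measurable_poweR.
by apply: measurableT_comp => //; exact/measurable_EFinP.
Qed.

Lemma Lfun_le (f g : Y -> R) : measurable_fun setT f ->
  (forall y, 0 <= f y <= g y) ->
  g \in Lfun lambda p%:E -> f \in Lfun lambda p%:E.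
Proof.
move=> mf fg; rewrite !inE => /andP[mg Lg]; apply/andP; split; first by rewrite inE.
move: mg Lg; rewrite !inE /finite_norm => mg Lg.
apply: le_lt_trans Lg; rewrite unlock.
have p0 : 0 < p by exact: lt_le_trans p1.
apply: gt0_ler_poweR.
- by rewrite invr_ge0 ltW.
- by rewrite in_itv/= leey integral_ge0// => y _; exact: poweR_ge0.
- by rewrite in_itv/= leey integral_ge0// => y _; exact: poweR_ge0.
- apply: ge0_le_integral => //=.
  + exact: measurable_powp.
  + exact: measurable_powp.
  + move=> y _; have /andP[f0 fgy] := fg y.
    have g0 := le_trans f0 fgy.
    by rewrite !lee_fin ge0_ler_powR// ?nnegrE ?(ltW p0)// !ger0_norm.
Qed.

Lemma Lp_submod : submod_closed (Lp_pred p1).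
Proof.
split.
  apply/Lp_predP; split.
    by split; rewrite [X in measurable_fun _ X](_ : _ = cst 0)//; apply/funext.
  rewrite (_ : (fun y => _) = 0) ?rpred0//.
  by apply/funext => y; rewrite /rnorm normr0.
move=> a f g /Lp_predP[[rf mf] Lf] /Lp_predP[[rg mg] Lg]; apply/Lp_predP.
have mh : cmeasurable (a *: f + g).
  case: a => ar ai; split.
    rewrite (_ : (fun y => _) = (fun y => ar * complex.Re (f y) -
        ai * complex.Im (f y) + complex.Re (g y))); last first.
      apply/funext => y /=; rewrite /GRing.add/= /GRing.scale/=.
      by case: (f y) => ? ?; case: (g y).
    apply: measurable_funD => //; apply: measurable_funB;
      exact: measurable_funM.
  rewrite (_ : (fun y => _) = (fun y => ar * complex.Im (f y) +
      ai * complex.Re (f y) + complex.Im (g y))); last first.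
    apply/funext => y /=; rewrite /GRing.add/= /GRing.scale/=.
    by case: (f y) => ? ?; case: (g y).
  apply: measurable_funD => //; apply: measurable_funD;
    exact: measurable_funM.
split=> //; apply: (@Lfun_le _ (rnorm a *: (fun y => rnorm (f y)) +
    (fun y => rnorm (g y)))).
- exact: measurable_rnorm.
- move=> y; rewrite rnorm_ge0/=.
  apply: le_trans (ler_rnormD _ _) _; rewrite lerD2r.
  by rewrite [leLHS](_ : _ = rnorm a * rnorm (f y))//; exact: rnormM.
- have p1' : (1 <= p%:E)%E by rewrite lee_fin.
  by have [_] := Lfun_submod_closed lambda p1'; apply.
Qed.
HB.instance Definition _ :=
  GRing.isSubmodClosed.Build C (Y -> C) (Lp_pred p1) Lp_submod.

(* p-integrable functions, before identification of a.e. equal ones *)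
Record Lp_fun :=
  LpFun { Lp_fun_fun :> Y -> C ; Lp_funP : Lp_fun_fun \in Lp_pred p1 }.
HB.instance Definition _ := [isSub for Lp_fun_fun].
HB.instance Definition _ := [Choice of Lp_fun by <:].
HB.instance Definition _ := [SubChoice_isSubLmodule of Lp_fun by <:].

Definition Lp_null : {pred Lp_fun} :=
  mem [set f : Lp_fun | {ae lambda, forall y, f y = 0}].

Lemma Lp_nullP (f : Lp_fun) :
  reflect {ae lambda, forall y, f y = 0} (f \in Lp_null).
Proof. by apply: (iffP idP) => [/set_mem//|?]; apply: mem_set. Qed.

Lemma Lp_null_zmod : zmod_closed Lp_null.
Proof.
split; first by apply/Lp_nullP; exact: aeW.
move=> f g /Lp_nullP f0 /Lp_nullP g0; apply/Lp_nullP.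
apply: filterS2 f0 g0 => y /= fy gy.
by rewrite [LHS](_ : _ = f y - g y)// fy gy subrr.
Qed.
HB.instance Definition _ := GRing.isZmodClosed.Build Lp_fun Lp_null Lp_null_zmod.

Definition Lp := Quotient.quot Lp_null.
HB.instance Definition _ := GRing.Zmodule.on Lp.
HB.instance Definition _ := EqQuotient.on Lp.

Definition Lp_class (f : Lp_fun) : Lp := \pi_Lp f.
Definition Lp_scale (c : C) (u : Lp) : Lp := Lp_class (c *: repr u).

Lemma Lp_class_eqP (f g : Lp_fun) :
  Lp_class f = Lp_class g <-> {ae lambda, forall y, f y = g y}.
Proof.
split=> [/eqP|fg].
  rewrite /Lp_class -Quotient.idealrBE => /Lp_nullP; apply: filterS => y /=.
  by move=> /eqP; rewrite subr_eq0 => /eqP.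
apply/eqP; rewrite /Lp_class -Quotient.idealrBE; apply/Lp_nullP.
apply: filterS fg => y fg.
by rewrite [LHS](_ : _ = f y - g y)// fg subrr.
Qed.

Lemma Lp_classK (u : Lp) : Lp_class (repr u) = u.
Proof. exact: reprK. Qed.

Lemma Lp_reprE (f : Lp_fun) : {ae lambda, forall y, repr (Lp_class f) y = f y}.
Proof. by apply/Lp_class_eqP; rewrite /Lp_class reprK. Qed.

Lemma Lp_classD f g : Lp_class (f + g) = Lp_class f + Lp_class g.
Proof. exact: raddfD. Qed.

Lemma Lp_classZ c f : Lp_class (c *: f) = Lp_scale c (Lp_class f).
Proof.
apply/Lp_class_eqP; apply: filterS (Lp_reprE f) => y fy.
by rewrite [RHS](_ : _ = c *: repr (Lp_class f) y)// fy.
Qed.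

Lemma Lp_scaleA a b u : Lp_scale a (Lp_scale b u) = Lp_scale (a * b) u.
Proof. by rewrite -[u]Lp_classK -!Lp_classZ scalerA. Qed.

Lemma Lp_scale1 : left_id 1 Lp_scale.
Proof. by move=> u; rewrite -[u in LHS]Lp_classK -Lp_classZ scale1r Lp_classK. Qed.

Lemma Lp_scaleDr : right_distributive Lp_scale +%R.
Proof.
move=> a u v; rewrite -[u]Lp_classK -[v]Lp_classK -Lp_classD -!Lp_classZ.
by rewrite scalerDr Lp_classD.
Qed.

Lemma Lp_scaleDl u : {morph Lp_scale^~ u : a b / a + b}.
Proof.
by move=> a b /=; rewrite -[u]Lp_classK -!Lp_classZ scalerDl Lp_classD.
Qed.
HB.instance Definition _ := GRing.Zmodule_isLmodule.Build C Lp
  Lp_scaleA Lp_scale1 Lp_scaleDr Lp_scaleDl.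

Definition Lp_norm (u : Lp) : \bar R :=
  Lnorm lambda p%:E (fun y => (rnorm (repr u y))%:E).

Lemma Lp_normE (f : Lp_fun) :
  Lp_norm (Lp_class f) = Lnorm lambda p%:E (fun y => (rnorm (f y))%:E).
Proof.
have mLp (g : Lp_fun) :
    measurable_fun setT (fun y => `|(rnorm (g y))%:E| `^ p)%E.
  apply: measurable_powp; apply: measurable_rnorm.
  by have /Lp_predP[] := Lp_funP g.
rewrite /Lp_norm unlock; congr poweR; apply: ae_eq_integral => //; try exact: mLp.
by apply: filterS (Lp_reprE f) => y -> _.
Qed.

End Lp_functions.

Section convex_combination.
Context d (T : measurableType d) (R : realType).
Variables (t : R) (t01 : 0 <= t <= 1) (mu nu : probability T R).

Let t0 : 0 <= t. Proof. by case/andP: t01. Qed.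
Let t1 : 0 <= 1 - t. Proof. by rewrite subr_ge0; case/andP: t01. Qed.

Definition prob_conv : set T -> \bar R :=
  measure_add (mscale (NngNum t0) mu) (mscale (NngNum t1) nu).
HB.instance Definition _ := Measure.on prob_conv.

Lemma prob_convE B : prob_conv B = (t%:E * mu B + (1 - t)%:E * nu B)%E.
Proof. by rewrite /prob_conv measure_addE. Qed.

Let prob_conv_setT : prob_conv setT = 1%E.
Proof. by rewrite prob_convE !probability_setT !mule1 -EFinD addrC subrK. Qed.
HB.instance Definition _ := Measure_isProbability.Build _ _ _ prob_conv
  prob_conv_setT.
End convex_combination.

Section crossed_product_algebra.
Context (R : realType) (G : groupType) (X : topologicalType).
Variable a : gspace G X.
Local Notation C := (Cx R).
Local Notation CX := (contfun R X).

Lemma translate_subproof g (f : CX) :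
  (fun x => f (a g^-1%g x)) \in @cont_pred R X.
Proof.
apply/cont_predP => x; apply: continuous_comp; first exact: act_continuous.
by have /cont_predP := contfunP f; apply.
Qed.
Definition translate g (f : CX) : CX := ContFun (translate_subproof g f).

Definition fsupp_pred : {pred G -> CX} :=
  mem [set x : G -> CX | finite_set [set g | x g != 0]].

Lemma fsupp_predP x :
  reflect (finite_set [set g | x g != 0]) (x \in fsupp_pred).
Proof. by apply: (iffP idP) => [/set_mem//|?]; apply: mem_set. Qed.

Lemma fsupp_submod : submod_closed fsupp_pred.
Proof.
split.
  apply/fsupp_predP; rewrite (_ : [set g | _] = set0)//.
  by apply/seteqP; split => g //=; rewrite eqxx.
move=> c x y /fsupp_predP fx /fsupp_predP fy; apply/fsupp_predP.
apply: (@sub_finite_set _ _ ([set g | x g != 0] `|` [set g | y g != 0])).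
  move=> g /= xy0; apply/orP; apply: contraNT xy0.
  rewrite negb_or !negbK => /andP[/eqP x0 /eqP y0].
  by apply/eqP; rewrite [LHS](_ : _ = c *: x g + y g)// x0 y0 scaler0 addr0.
by rewrite finite_setU.
Qed.
HB.instance Definition _ :=
  GRing.isSubmodClosed.Build C (G -> CX) fsupp_pred fsupp_submod.

(* x : Cc stands for the finite sum of the (x g) u_g *)
Record Cc := MkCc { Cc_fun :> G -> CX ; CcP : Cc_fun \in fsupp_pred }.
HB.instance Definition _ := [isSub for Cc_fun].
HB.instance Definition _ := [Choice of Cc by <:].
HB.instance Definition _ := [SubChoice_isSubLmodule of Cc by <:].

Lemma Cc_mul_subproof (x y : Cc) :
  (fun k => \sum_(g \in [set: G]) x g * translate g (y (g^-1 * k)%g))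
    \in fsupp_pred.
Proof.
apply/fsupp_predP.
have /fsupp_predP fx := CcP x; have /fsupp_predP fy := CcP y.
apply: (@sub_finite_set _ _ [set (g * h)%g | g in [set g | x g != 0] &
  h in [set g | y g != 0]]); last exact: finite_image2.
move=> k /=; apply: contraNP => xyk; apply/eqP.
apply: fsbig1 => g _; have [->|xg] := eqVneq (x g) 0; first by rewrite mul0r.
have [yg|yg] := eqVneq (y (g^-1 * k)%g) 0.
  rewrite [X in _ * X](_ : _ = 0) ?mulr0//.
  by apply: val_inj; apply/funext => z; rewrite /= yg.
by exfalso; apply: xyk; exists g => //; exists (g^-1 * k)%g => //; rewrite mulVKg.
Qed.

(* (f u_g) (k u_h) = f (translate g k) u_(gh), extended bilinearly *)
Definition Cc_mul (x y : Cc) : Cc := MkCc (Cc_mul_subproof x y).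

Lemma Cc_single_subproof (f : CX) (g : G) :
  (fun h => if h == g then f else 0) \in fsupp_pred.
Proof.
apply/fsupp_predP; apply: (@sub_finite_set _ _ [set g]) => // h /=.
by case: ifP => [/eqP//|_]; rewrite eqxx.
Qed.
Definition Cc_single (f : CX) (g : G) : Cc := MkCc (Cc_single_subproof f g).

End crossed_product_algebra.
Arguments Cc_single {R G X} f g.

Section crossed_product_norm.
Context (R : realType) (p : R) (G : groupType) (X : topologicalType).
Variables (p1 : 1 <= p) (a : gspace G X).
Local Notation C := (Cx R).
Local Notation CX := (contfun R X).

(* norm of l^p(G, V) for a space V with norm nV; +oo outside l^p(G, V) *)
Definition ell_norm (V : Type) (nV : V -> \bar R) (xi : G -> V) : \bar R :=
  ((\esum_(h in [set: G]) (nV (xi h) `^ p)) `^ p^-1)%E.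

Section representation.
Context d (Y : measurableType d) (lambda : {measure set Y -> \bar R}).
Local Notation LpY := (Lp lambda p1).
Variable pi0 : CX -> LpY -> LpY.

Record contractive_representation : Prop := {
  rep_op_linear : forall f, linear (pi0 f) ;
  rep_linear : forall c f k xi,
    pi0 (c *: f + k) xi = c *: pi0 f xi + pi0 k xi ;
  repM : forall f k xi, pi0 (f * k) xi = pi0 f (pi0 k xi) ;
  rep_contractive : forall f,
    (opnorm (@Lp_norm _ _ _ lambda p p1) (@Lp_norm _ _ _ lambda p p1) (pi0 f)
       <= (supnorm f)%:E)%E }.

Definition nondegenerate := forall (xi : LpY) (e : R), 0 < e ->
  exists n (c : 'I_n -> C) (f : 'I_n -> CX) (eta : 'I_n -> LpY),
    (Lp_norm (xi - \sum_i c i *: pi0 (f i) (eta i))%R < e%:E)%E.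

Definition reg_v (g : G) (xi : G -> LpY) : G -> LpY :=
  fun h => xi (g^-1 * h)%g.

Definition reg_pi (f : CX) (xi : G -> LpY) : G -> LpY :=
  fun h => pi0 (translate a h^-1%g f) (xi h).

Definition integrated_form (x : Cc R G X) (xi : G -> LpY) : G -> LpY :=
  \sum_(g \in [set: G]) reg_pi (x g) (reg_v g xi).

Definition regular_norm (x : Cc R G X) : \bar R :=
  opnorm (ell_norm (@Lp_norm _ _ _ lambda p p1))
    (ell_norm (@Lp_norm _ _ _ lambda p p1)) (integrated_form x).
End representation.

Definition reduced_seminorm (x : Cc R G X) : \bar R :=
  ereal_sup [set r | exists d (Y : measurableType d)
    (lambda : {measure set Y -> \bar R}) (pi0 : CX -> Lp lambda p1 -> Lp lambda p1),
    [/\ sigma_finite [set: Y] lambda, contractive_representation pi0,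
        nondegenerate pi0 & r = regular_norm pi0 x]].

(* (A, iota) is a Hausdorff completion of Cc for reduced_seminorm; any two are
   isometrically isomorphic over Cc. *)
Record is_reduced_crossed_product (A : banachAlgType C) (iota : Cc R G X -> A)
    : Prop := {
  iota_linear : linear iota ;
  iotaM : forall x y, iota (Cc_mul a x y) = bmul (iota x) (iota y) ;
  iota1 : iota (Cc_single 1 1%g) = bone ;
  iota_isometric : forall x, (rnorm (iota x))%:E = reduced_seminorm x ;
  iota_dense : closure (range iota) = setT }.

Record is_standard_expectation (A : banachAlgType C) (iota : Cc R G X -> A)
    (E : A -> CX) : Prop := {
  expectation_linear : linear E ;
  expectation_contractive : forall x, supnorm (E x) <= rnorm x ;
  expectation_iota : forall x, E (iota x) = x 1%g }.
End crossed_product_norm.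

Definition is_normalized_trace (R : realType) (A : banachAlgType (Cx R))
    (tau : A -> Cx R) : Prop :=
  [/\ linear tau, tau bone = 1,
      opnorm (fun x => (rnorm x)%:E) (fun z => (rnorm z)%:E) tau = 1%E &
      forall x y, tau (bmul y x) = tau (bmul x y)].

Section borel_measures.
Context (R : realType) (G : groupType) (X : ptopologicalType).

Definition borel := g_sigma_algebraType (@open X).

(* Measures are functions on all sets of points whose values on non-measurable
   sets are irrelevant; borel_eq is equality as Borel measures. *)
Definition borel_eq (mu nu : {measure set borel -> \bar R}) :=
  forall B : set borel, measurable B -> mu B = nu B.

Definition invariant_measure (a : gspace G X) (mu : {measure set borel -> \bar R}) :=
  forall g (B : set borel), measurable B -> mu (a g @^-1` B) = mu B.

Definition cintegral (mu : {measure set borel -> \bar R}) (f : X -> Cx R)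
    : Cx R :=
  Complex (\int[mu]_x complex.Re (f x)) (\int[mu]_x complex.Im (f x)).

Definition trace_of (A : Type) (E : A -> contfun R X)
    (mu : {measure set borel -> \bar R}) : A -> Cx R :=
  fun x => cintegral mu (E x).

(* mu is the measure given by the Riesz representation theorem for phi *)
Definition riesz_measure (phi : contfun R X -> Cx R)
    (mu : {finite_measure set borel -> \bar R}) :=
  (forall f, phi f = cintegral mu f) /\
  (forall nu : {finite_measure set borel -> \bar R},
     (forall f, phi f = cintegral nu f) -> borel_eq nu mu).
End borel_measures.
Arguments borel : clear implicits.

(* Main.v *)
(* An invariant measure gives a trace because [E] of a product of two elements
   [f u_g] and [k u_h] vanishes unless [h = g^-1], and in that case exchanging
   the two factors translates the result by [g].

   Conversely, a normalized trace restricts to a unital functional of norm one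
   on [C(X)], hence is given there by a probability measure. The measure is
   built in the manner of Daniell, from the outer measure sending [A] to the
   infimum of the [\sum_n L (f n)] over the nonnegative continuous [f n] with
   [\sum_n f n >= 1] on [A]. It is invariant since [f] and [u_g f u_g^-1] have
   the same trace, and freeness forces the trace to vanish on [f u_g] for
   [g <> 1]; by density of the finite sums the trace is that of the measure. *)
From HB Require Import structures.
Require Import Defs.
From mathcomp Require Import all_boot all_order all_algebra.
From mathcomp Require Import all_classical all_reals all_analysis.
From mathcomp Require Import complex ring lra measurable_realfun.
Set Implicit Arguments.
Unset Strict Implicit.
Unset Printing Implicit Defensive.
Import Order.TTheory GRing.Theory Num.Theory.
Import numFieldNormedType.Exports.
Local Open Scope classical_set_scope.
Local Open Scope ring_scope.

(** The crossed product is known only as a completion of [Cc]. Identities between functionals are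
    therefore checked on the terms [Cc_single f g] and carried over by boundedness and density. The
    one estimate of the reduced seminorm is that [f u_1] has norm at most [supnorm f]; it makes a
    trace contractive on C(X) and puts [bone] in the unit ball. Metrizability enters in two ways. An
    open set is the positivity set of a continuous function, so its indicator is an increasing limit
    of continuous functions; this makes open sets measurable for the Daniell outer measure and lets
    a finite measure be recovered from its integrals. Moreover a distance function separates [x]
    from [g^-1 x], which is how freeness becomes a statement about C(X). *)

Section metrizable_space.
Context (R : realType) (X : topologicalType).

Lemma metrizable_continuous (d : X -> X -> R) (f : X -> R) :
  (forall x y, d x y = d y x) ->
  (forall x (B : set X),
     nbhs x B <-> exists2 e, 0 < e & [set y | d x y < e] `<=` B) ->
  (forall x y, f x <= f y + d x y) -> continuous f.
Proof.
move=> dC nbhsd fd x; apply/cvgrPdist_lt => e e0.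
apply/nbhsd; exists e => // y /= dxy.
by rewrite ltr_norml; have := fd x y; have := fd y x; rewrite (dC y x); lra.
Qed.

Hypothesis metrizableX : metrizable X R.

Lemma metrizable_separates (x y : X) : x <> y ->
  exists2 k : X -> R, continuous k & k x <> k y.
Proof.
have [d [d0 d00 dC dT nbhsd]] := metrizableX => xy.
exists (d x).
  apply: (metrizable_continuous dC nbhsd) => u v.
  by have := dT x v u; rewrite (dC v u).
have -> : d x x = 0 by exact/d00.
by move=> /esym/d00.
Qed.

Lemma metrizable_cozero (U : set X) : open U ->
  exists k : X -> R, [/\ continuous k, forall x, 0 <= k x & U = [set x | 0 < k x]].
Proof.
have [d [d0 d00 dC dT nbhsd]] := metrizableX => oU.
(* The infimum is the distance to the complement, truncated at 1. The value 1 keeps the set nonempty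
   when [U] is the whole space. *)
pose S x := [set r : R | r = 1 \/ exists2 y, ~ U y & r = d x y].
have S0 x : S x !=set0 by exists 1; left.
have Sl x : lbound (S x) 0 by move=> r [->|[y _ ->]].
have infS x : has_inf (S x) by split=> //; exists 0.
have k0 x : 0 <= inf (S x) by exact: lb_le_inf.
exists (inf \o S); split => //.
  apply: (metrizable_continuous dC nbhsd) => x y /=.
  rewrite -lerBlDr; apply: lb_le_inf => // r [->|[z Uz ->]].
    by rewrite lerBlDr (le_trans (ge_inf (proj2 (infS x)) (or_introl erefl)))// lerDl.
  rewrite lerBlDr addrC.
  apply: (le_trans (ge_inf (proj2 (infS x)) _) (dT x y z)).
  by right; exists z.
apply/seteqP; split => x /=.
  move=> Ux; have /nbhsd[e e0 eU] := open_nbhs_nbhs (conj oU Ux).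
  apply: (@lt_le_trans _ _ (Num.min e 1)); first by rewrite lt_min e0 ltr01.
  apply: lb_le_inf => // r [->|[y Uy ->]]; first by rewrite ge_min lexx orbT.
  rewrite ge_min leNgt; apply/orP; left; apply/negP => /eU.
  exact: Uy.
apply: contraPP => Ux; apply/negP; rewrite -leNgt.
apply: ge_inf; first by exists 0.
by right; exists x => //; apply/esym/d00.
Qed.

(** Truncating the multiples [n * k] of a function positive exactly on [U] gives the sequence. It
    starts at 0 so that its increments telescope to [h M] in [open_caratheodory]. *)
Lemma open_approximation (U : set X) : open U ->
  exists h : nat -> X -> R, [/\ forall n, continuous (h n),
    forall n x, 0 <= h n x <= 1, forall x, {homo h^~ x : m n / (m <= n)%N >-> m <= n},
    forall x, h 0%N x = 0 &
    forall x, h^~ x @ \oo --> (\1_U x : R)].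
Proof.
move=> /metrizable_cozero[k [ck k0 ->]].
pose h (n : nat) x := Num.min 1 (n%:R * k x).
have h01 n x : 0 <= h n x <= 1.
  by rewrite le_min ler01/= mulr_ge0//= ge_min lexx.
have homoh x : {homo h^~ x : m n / (m <= n)%N >-> m <= n}.
  move=> m n mn; rewrite le_min ge_min lexx/= ge_min; apply/orP; right.
  by rewrite ler_wpM2r// ler_nat.
have h0 x : h 0%N x = 0 by rewrite /h mul0r; apply/min_idPr; exact: ler01.
exists h; split => //.
- move=> n x; apply: (@continuous_min R X (cst 1) (fun x => n%:R * k x)).
    exact: cvg_cst.
  by apply: cvgM; [exact: cvg_cst|exact: ck].
- move=> x; rewrite indicE; case: (boolP (x \in _)) => [/set_mem/= kx|].
    have [N NP] : exists N : nat, (k x)^-1 <= N%:R.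
      exists (Num.truncn (k x)^-1).+1; apply/ltW.
      by rewrite truncnS_gt.
    apply: cvg_near_cst; exists N => // n /= Nn; apply/min_idPl.
    rewrite -ler_pdivrMr// mul1r (le_trans NP)//.
    by rewrite ler_nat.
  move=> /negP kx; have {}kx : k x = 0.
    apply/eqP; rewrite eq_le k0 andbT leNgt; apply/negP => kx0.
    by apply: kx; apply/mem_set.
  apply: cvg_near_cst; apply: nearW => n; rewrite /h kx mulr0.
  by apply/min_idPr; exact: ler01.
Qed.

End metrizable_space.

(** * The Riesz representation theorem for compact metrizable spaces *)

Section nneseries.
Context (R : realType).
Local Open Scope ereal_scope.

Lemma nneseries_le (a : nat -> \bar R) (B : \bar R) : (forall n, 0 <= a n) ->
  (forall N, \sum_(0 <= n < N) a n <= B) -> \sum_(n <oo) a n <= B.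
Proof.
move=> a0 aB; apply: lime_le; first exact: is_cvg_nneseries.
exact: nearW.
Qed.

Lemma nneseries2_le (a : nat -> nat -> \bar R) (B : \bar R) :
  (forall n m, 0 <= a n m) ->
  (forall N M, \sum_(0 <= n < N) \sum_(0 <= m < M) a n m <= B) ->
  \sum_(n <oo) \sum_(m <oo) a n m <= B.
Proof.
move=> a0 aB; apply: nneseries_le => [n|N]; first exact: nneseries_ge0.
rewrite -nneseries_sum_nat//; apply: nneseries_le => [m|M].
  exact: sume_ge0.
by rewrite exchange_big_nat.
Qed.

(** Nonnegative terms may be summed in any order, so both sides are the unordered sum over all
    pairs. It turns doubly indexed families into covers, which are sequences. *)
Lemma nneseries_pair (e : nat -> nat * nat) (a : nat -> nat -> \bar R) :
  set_bij setT setT e -> (forall n m, 0 <= a n m) ->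
  \sum_(k <oo) a (e k).1 (e k).2 = \sum_(n <oo) \sum_(m <oo) a n m.
Proof.
move=> be a0; rewrite nneseries_esumT//.
under [RHS]eq_eseriesr do rewrite nneseries_esumT//.
rewrite nneseries_esumT => [|n]; last exact: esum_ge0.
rewrite esum_esum// -(@reindex_esum _ _ _ _ _ _ (fun k => a k.1 k.2) be).
by congr esum; apply/seteqP; split.
Qed.

Lemma eseries_single (x : \bar R) :
  \sum_(k <oo) (if k == 0%N then x else 0) = x.
Proof.
apply/cvg_lim => //; apply: cvg_near_cst; exists 1%N => // -[//|n] _ /=.
by rewrite big_nat_recl// big1 ?adde0.
Qed.

End nneseries.

Lemma exists_pairing : exists e : nat -> nat * nat, set_bij setT setT e.
Proof.
have /card_esym/ppcard_eqP[f] := card_nat2.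
by exists f; exact: bij.
Qed.

Section borel_integral.
Context (R : realType) (X : ptopologicalType).

Lemma open_borel_measurable (U : set X) : open U -> measurable (U : set (borel X)).
Proof. by move=> oU; exact: sub_sigma_algebra. Qed.

Lemma continuous_borel_measurable (f : X -> R) :
  continuous f -> measurable_fun [set: borel X] f.
Proof.
move=> cf; apply: (measurability _ (RGenOpens.measurableE R)).
move=> _ [_ [a [b ->] <-]]; rewrite setTI; apply: open_borel_measurable.
by apply: open_comp => [x _|]; [exact: cf|exact: interval_open].
Qed.

Hypothesis compactX : compact [set: X].

Lemma continuous_bounded (f : X -> R) : continuous f ->
  exists M : R, forall x, `|f x| <= M.
Proof.
move=> cf; have cN : continuous (fun x => `|f x|).
  by move=> x; apply: cvg_norm; exact: cf.
have [x _ fx] := @compact_EVT_max _ _ _ _ (ex_intro _ point I) compactX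
  (continuous_subspaceT cN).
by exists `|f x| => y; apply: fx; rewrite inE.
Qed.

Lemma continuous_integrable (mu : {finite_measure set (borel X) -> \bar R})
  (f : X -> R) : continuous f -> mu.-integrable setT (EFin \o f).
Proof.
move=> cf; apply: measurable_bounded_integrable => //.
- by rewrite ltey_eq fin_num_measure.
- exact: continuous_borel_measurable.
have [M fM] := continuous_bounded cf.
by exists M; split; [exact: num_real|move=> N MN x _ /=; rewrite (le_trans (fM x))// ltW].
Qed.

End borel_integral.

(** * The Daniell measure of a positive functional *)

Section daniell.
Context (R : realType) (X : ptopologicalType).
Hypothesis compactX : compact [set: X].
Hypothesis metrizableX : metrizable X R.
Variable L : (X -> R) -> R.
Hypothesis LD : forall f g : X -> R, continuous f -> continuous g ->
  L (fun x => f x + g x) = L f + L g.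
Hypothesis LZ : forall (c : R) (f : X -> R), continuous f ->
  L (fun x => c * f x) = c * L f.
Hypothesis L_ge0 : forall f : X -> R, continuous f -> (forall x, 0 <= f x) -> 0 <= L f.
Hypothesis L1 : L (cst 1) = 1.

Let cst_cont (c : R) : continuous (cst c : X -> R).
Proof. by move=> x; exact: cvg_cst. Qed.

Let cD (f g : X -> R) : continuous f -> continuous g ->
  continuous (fun x => f x + g x).
Proof. by move=> cf cg x; apply: cvgD; [exact: cf|exact: cg]. Qed.

Let cB (f g : X -> R) : continuous f -> continuous g ->
  continuous (fun x => f x - g x).
Proof. by move=> cf cg x; apply: cvgB; [exact: cf|exact: cg]. Qed.

Let cM (f g : X -> R) : continuous f -> continuous g ->
  continuous (fun x => f x * g x).
Proof. by move=> cf cg x; apply: cvgM; [exact: cf|exact: cg]. Qed.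

Let csum (f : nat -> X -> R) N : (forall n, continuous (f n)) ->
  continuous (fun x => \sum_(0 <= n < N) f n x).
Proof.
move=> cf; elim: N => [|N IH].
  rewrite (_ : (fun _ => _) = cst 0); first exact: cst_cont.
  by apply/funext => x; rewrite big_geq.
rewrite (_ : (fun _ => _) = (fun x => \sum_(0 <= n < N) f n x + f N x)).
  exact: cD.
by apply/funext => x; rewrite big_nat_recr.
Qed.

Let L0 : L (cst 0) = 0.
Proof.
rewrite (_ : cst 0 = (fun x => 0 * cst 1 x)) ?LZ ?mul0r//.
by apply/funext => x; rewrite mul0r.
Qed.

Let LB (f g : X -> R) : continuous f -> continuous g ->
  L (fun x => f x - g x) = L f - L g.
Proof.
move=> cf cg; rewrite (_ : (fun _ => _) = (fun x => f x + -1 * g x)).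
  rewrite LD ?LZ// ?mulN1r//.
  by move=> x; apply: cvgM; [exact: cvg_cst|exact: cg].
by apply/funext => x; rewrite mulN1r.
Qed.

Let L_le (f g : X -> R) : continuous f -> continuous g -> (forall x, f x <= g x) ->
  L f <= L g.
Proof.
move=> cf cg fg; rewrite -subr_ge0 -LB//; apply: L_ge0; first exact: cB.
by move=> x; rewrite subr_ge0.
Qed.

Let Lsum (f : nat -> X -> R) N : (forall n, continuous (f n)) ->
  L (fun x => \sum_(0 <= n < N) f n x) = \sum_(0 <= n < N) L (f n).
Proof.
move=> cf; elim: N => [|N IH].
  rewrite big_geq// -L0; congr L.
  by apply/funext => x; rewrite big_geq.
rewrite big_nat_recr//= -IH -LD//; last exact: csum.
by congr L; apply/funext => x; rewrite big_nat_recr.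
Qed.

Definition daniell_cover (A : set X) := [set f : nat -> X -> R |
  [/\ forall n, continuous (f n), forall n x, 0 <= f n x &
      forall x, A x -> (1 <= \sum_(n <oo) (f n x)%:E)%E]].

Definition daniell (A : set X) : \bar R :=
  ereal_inf [set \sum_(n <oo) (L (f n))%:E | f in daniell_cover A]%E.

Let Lf0 (f : nat -> X -> R) n : continuous (f n) -> (forall x, 0 <= f n x) ->
  (0 <= (L (f n))%:E)%E.
Proof. by move=> cf f0; rewrite lee_fin L_ge0. Qed.

Lemma daniell_ge0 A : (0 <= daniell A)%E.
Proof.
apply: le_ereal_inf_tmp => _ [f [cf f0 _] <-].
by apply: nneseries_ge0 => n _ _; exact: Lf0.
Qed.

Lemma le_daniell : {homo daniell : A B / A `<=` B >-> (A <= B)%E}.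
Proof.
move=> A B AB; apply: ereal_inf_le_tmp => _ [f [cf f0 fB] <-].
by exists f => //; split => // x /AB /fB.
Qed.

Lemma daniell_le A (f : X -> R) : continuous f -> (forall x, 0 <= f x) ->
  (forall x, A x -> 1 <= f x) -> (daniell A <= (L f)%:E)%E.
Proof.
move=> cf f0 f1; apply: ereal_inf_lbound.
exists (fun n => if n == 0%N then f else cst 0).
  split=> [[|n]//|[|n]//= x|x Ax]; first exact: cst_cont.
  under eq_eseriesr => n _.
    rewrite (_ : _%:E = if n == 0%N then (f x)%:E else 0%E); last by case: n.
    over.
  by rewrite eseries_single lee_fin f1.
under eq_eseriesr => n _.
  rewrite (_ : _%:E = if n == 0%N then (L f)%:E else 0%E); last first.
    by case: n => //=; rewrite L0.
  over.
exact: eseries_single.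
Qed.

Lemma daniell_le1 A : (daniell A <= 1)%E.
Proof. by rewrite -L1; apply: daniell_le => // x; exact: ler01. Qed.

Lemma daniell_fin A : daniell A \is a fin_num.
Proof.
by rewrite ge0_fin_numE ?daniell_ge0// (le_lt_trans (daniell_le1 A))// ltry.
Qed.

Lemma daniell0 : daniell set0 = 0%E.
Proof.
apply/eqP; rewrite eq_le daniell_ge0 andbT.
by rewrite -[leRHS]/(0%:E) -L0; exact: daniell_le.
Qed.

Lemma daniell_le_double A (f : nat -> nat -> X -> R) :
  (forall n m, continuous (f n m)) -> (forall n m x, 0 <= f n m x) ->
  (forall x, A x -> (1 <= \sum_(n <oo) \sum_(m <oo) (f n m x)%:E)%E) ->
  (daniell A <= \sum_(n <oo) \sum_(m <oo) (L (f n m))%:E)%E.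
Proof.
move=> cf f0 f1; have [e be] := exists_pairing.
apply: ereal_inf_lbound; exists (fun k => f (e k).1 (e k).2).
  split => // x /f1; rewrite -(nneseries_pair be)//.
  by move=> n m; rewrite lee_fin.
by rewrite /= -(nneseries_pair be)// => n m; rewrite lee_fin L_ge0.
Qed.

Lemma daniell_sigma_subadditive : sigma_subadditive daniell.
Proof.
move=> A; apply/lee_addgt0Pr => _/posnumP[e].
rewrite (le_trans _ (epsilon_trick _ _ _))//; last by move=> n; exact: daniell_ge0.
pose P n (f : nat -> X -> R) := daniell_cover (A n) f /\
  (\sum_(k <oo) (L (f k))%:E <= daniell (A n) + (e%:num / (2 ^ n.+1)%:R)%:E)%E.
have [F PF] : {F : nat -> nat -> X -> R & forall n, P n (F n)}.
  apply: (@choice _ _ P) => n.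
  have en : 0 < e%:num / (2 ^ n.+1)%:R :> R by [].
  have [_ [f fA <-] fe] := lb_ereal_inf_adherent en (daniell_fin (A n)).
  by exists f; split => //; exact: ltW.
have cF n m : continuous (F n m) by have [[]] := PF n.
have F0 n m x : 0 <= F n m x by have [[]] := PF n.
apply: (@le_trans _ _ (\sum_(n <oo) \sum_(m <oo) (L (F n m))%:E)%E).
  apply: daniell_le_double => // x [n _ Ax].
  have [[_ _ /(_ _ Ax)/le_trans H] _] := PF n; apply: H.
  (* The cover of the set that contains [x] already sums to at least 1 there; the other covers only
     add nonnegative terms. *)
  rewrite (@nneseriesD1 _ (fun n => \sum_(m <oo) (F n m x)%:E)%E n)//; last first.
    by move=> *; apply: nneseries_ge0 => *; rewrite lee_fin.
  rewrite leeDl//; apply: nneseries_ge0 => *.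
  by apply: nneseries_ge0 => *; rewrite lee_fin.
apply: lee_nneseries => [n _|n _]; last exact: (PF n).2.
by move=> _; apply: nneseries_ge0 => *; rewrite lee_fin L_ge0.
Qed.

HB.instance Definition _ := isOuterMeasure.Build R X daniell
  daniell0 daniell_ge0 le_daniell daniell_sigma_subadditive.

(* Given a cover [f] of [A] and [h m] increasing to the indicator of [U], the
   [f n * (h m.+1 - h m)] cover [A `&` U] and, for each [M], the
   [f n * (1 - h M)] cover [A `&` ~` U]. *)
Lemma open_caratheodory U : open U -> daniell.-caratheodory U.
Proof.
move=> oU; have [h [ch h01 hle h0 hU]] := open_approximation metrizableX oU.
have hge0 m x : 0 <= h m x by have /andP[] := h01 m x.
have hle1 m x : h m x <= 1 by have /andP[] := h01 m x.
have hS m x : 0 <= h m.+1 x - h m x by rewrite subr_ge0 hle.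
apply: (@le_caratheodory_measurable _ _ daniell) => A.
apply: le_ereal_inf_tmp => _ [f [cf f0 fA] <-].
set S := (\sum_(n <oo) _)%E.
pose F n m x := f n x * (h m.+1 x - h m x).
have cF n m : continuous (F n m) by apply: cM => //; exact: cB.
have F0 n m x : 0 <= F n m x by rewrite mulr_ge0.
have sumF n x M : \sum_(0 <= m < M) F n m x = f n x * h M x.
  by rewrite -mulr_sumr telescope_sumr// h0 subr0.
have c1h M : continuous (fun x => 1 - h M x).
  by apply: (@cB (cst 1) (h M)) => //; exact: cst_cont.
have outside M : (daniell (A `&` ~` U) <=
    \sum_(n <oo) (L (fun x => (f n x * (1 - h M x))%R))%:E)%E.
  apply: ereal_inf_lbound; exists (fun n x => f n x * (1 - h M x)) => //.
  split=> [n|n x|x [Ax Ux]].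
  - exact: cM.
  - by apply: mulr_ge0 => //; rewrite subr_ge0; exact: hle1.
  - suff -> : h M x = 0.
      by under eq_eseriesr do rewrite subr0 mulr1; exact: fA.
    apply/eqP; rewrite eq_le hge0 andbT.
    have : h^~ x @ \oo --> (0 : R).
      by have := hU x; rewrite indicE memNset.
    move=> hx; rewrite -(cvg_lim _ hx)//.
    apply: (nondecreasing_cvgn_le (hle x)).
    by apply/cvg_ex; exists 0.
(* For fixed [M] the inner sums telescope to [L] of [f n * h M], and adding [f n * (1 - h M)] gives
   back [f n]. The same [M] has to serve both halves, hence the finite rectangles. *)
have split_S N M : (\sum_(0 <= n < N) \sum_(0 <= m < M) (L (F n m))%:E +
    daniell (A `&` ~` U) <= S)%E.
  apply: (@le_trans _ _ (\sum_(n <oo) (L (fun x => (f n x * h M x)%R))%:E +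
     \sum_(n <oo) (L (fun x => (f n x * (1 - h M x))%R))%:E)%E).
    apply: leeD => //.
    under eq_bigr => n _.
      rewrite sumEFin -Lsum//.
      under [X in L X]eq_fun do rewrite sumF.
      over.
    apply: nneseries_lim_ge => n _.
    rewrite lee_fin L_ge0//; first exact: cM.
    by move=> x; rewrite mulr_ge0.
  rewrite -nneseriesD; last 2 first.
  - by move=> n _ _; rewrite lee_fin L_ge0//; [exact: cM|move=> x; rewrite mulr_ge0].
  - move=> n _ _; rewrite lee_fin L_ge0//; last first.
      by move=> x; apply: mulr_ge0 => //; rewrite subr_ge0; exact: hle1.
    exact: cM.
  rewrite le_eqVlt; apply/orP; left; apply/eqP/eq_eseriesr => n _.
  rewrite -EFinD -LD//; try exact: cM.
  by congr (L _)%:E; apply/funext => x; ring.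
(* The outer part is finite and does not depend on [M], so it can be subtracted. What remains is a
   double series, bounded through its finite rectangles by [split_S]. *)
rewrite -leeBrDr ?daniell_fin//.
apply: (@le_trans _ _ (\sum_(n <oo) \sum_(m <oo) (L (F n m))%:E)%E).
  apply: daniell_le_double => // x [Ax Ux].
  rewrite (le_trans (fA _ Ax))//.
  rewrite le_eqVlt; apply/orP; left; apply/eqP/eq_eseriesr => n _.
  apply/esym/cvg_lim => //.
  under eq_fun do rewrite sumEFin sumF.
  apply: cvg_EFin; first exact: nearW.
  rewrite -[X in _ --> X]mulr1; apply: cvgM; first exact: cvg_cst.
  by have := hU x; rewrite indicE mem_set.
apply: nneseries2_le => [n m|N M]; first by rewrite lee_fin L_ge0.
by rewrite leeBrDr ?daniell_fin.
Qed.

(** The lower bound is a Dini argument: the open sets [V N], where the partial sum of a cover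
    exceeds [1 - e], increase and exhaust the compact space. One of them is therefore everything,
    and [L] of that partial sum is at least [1 - e]. *)
Lemma daniell_setT : daniell setT = 1%E.
Proof.
apply/eqP; rewrite eq_le daniell_le1/=.
apply: le_ereal_inf_tmp => _ [f [cf f0 f1] <-].
apply/lee_subgt0Pr => e e0.
pose V N := [set x | 1 - e < \sum_(0 <= n < N) f n x].
have VS N M : (N <= M)%N -> V N `<=` V M.
  move=> NM x /lt_le_trans; apply.
  by rewrite (big_cat_nat _ NM)//= lerDl sumr_ge0.
have : cover_compact [set: X] by rewrite -compact_cover.
move=> /(_ nat setT V)[N _|x _|D _ DV].
- rewrite (_ : V N = (fun x => \sum_(0 <= n < N) f n x) @^-1` [set y | 1 - e < y])//.
  by apply: open_comp; [move=> x _; exact: csum|exact: open_gt].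
- have := f1 x I; rewrite -[X in (_ <= X)%E]/(limn _) => f1x.
  have : ((1 - e)%:E < \sum_(n <oo) (f n x)%:E)%E.
    by apply: lt_le_trans f1x; rewrite lte_fin ltrBlDr ltrDl.
  apply: contraPP => nV; apply/negP; rewrite -leNgt.
  apply: nneseries_le => [n|N]; first by rewrite lee_fin.
  rewrite sumEFin lee_fin leNgt; apply/negP => VN.
  by apply: nV; exists N.
pose N := \max_(i <- finmap.enum_fset D) i.
have VN x : V N x.
  have [n nD] := DV x I; apply: VS.
  by rewrite /N; apply: leq_bigmax_seq.
apply: (@le_trans _ _ (L (fun x => \sum_(0 <= n < N) f n x))%:E).
  rewrite -EFinB; have <- : L (fun x => (1 - e) * cst 1 x) = 1 - e.
    by rewrite LZ ?L1 ?mulr1//; exact: cst_cont.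
  rewrite lee_fin; apply: L_le.
  - by apply: (@cM (cst (1 - e)) (cst 1)); exact: cst_cont.
  - exact: csum.
  - by move=> x; rewrite mulr1; exact/ltW/VN.
rewrite Lsum// -sumEFin; apply: nneseries_lim_ge => n _.
by rewrite lee_fin L_ge0.
Qed.


Definition daniell_borel : set (borel X) -> \bar R := daniell.

Lemma borel_caratheodory (B : set (borel X)) :
  measurable B -> daniell.-caratheodory B.
Proof.
move=> mB; pose T := caratheodory_type daniell.
have := smallest_sub (@sigma_algebra_measurable _ T).
move=> /(_ (@open X)); apply => // U oU; exact: open_caratheodory.
Qed.

Let daniell_borel_sigma_additive : semi_sigma_additive daniell_borel.
Proof.
move=> F mF tF mUF; apply: (@caratheodory_measure_sigma_additive R X daniell) => //.
  by move=> n; exact: borel_caratheodory.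
exact: borel_caratheodory.
Qed.

HB.instance Definition _ := isMeasure.Build _ (borel X) R daniell_borel
  daniell0 daniell_ge0 daniell_borel_sigma_additive.

HB.instance Definition _ := Measure_isProbability.Build _ (borel X) R
  daniell_borel daniell_setT.

Definition daniell_probability : probability (borel X) R := daniell_borel.

(* [f] is cut into the slices [g j] of height [e], and [e * mu (K j) <= L (g j)]
   because [g j = e] on [K j]. *)
Lemma daniell_integral_le (f : X -> R) : continuous f -> (forall x, 0 <= f x) ->
  (\int[daniell_borel]_x (f x)%:E <= (L f)%:E)%E.
Proof.
move=> cf f0; apply/lee_addgt0Pr => e e0.
have mf : measurable_fun [set: borel X] f by exact: continuous_borel_measurable.
have [M fM] := continuous_bounded compactX cf.
(* Enough slices of height [e] to reach above the bound [M]. *)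
pose J := (Num.truncn (M / e)).+1.
have fJ x : f x <= J%:R * e.
  rewrite (le_trans (ler_norm _))// (le_trans (fM x))//.
  by rewrite -ler_pdivrMr// ltW// truncnS_gt.
pose g (j : nat) x := Num.min (Num.max (f x - j%:R * e) 0) e.
pose K (j : nat) := [set x | j.+1%:R * e <= f x].
have sumg x N : \sum_(0 <= j < N) g j x = Num.min (f x) (N%:R * e).
  elim: N => [|N IH].
    by rewrite big_geq// mul0r; apply/esym/min_idPr.
  rewrite big_nat_recr//= IH /g -natr1 mulrDl mul1r.
  rewrite /Num.min /Num.max; do ![case: ifPn]; rewrite -?leNgt; lra.
(* [K j] starts at height [j.+1 * e], so the step function lies below [f] and misses it by at most
   one slice. This accounts for the term [e], whose integral is [e] because the total mass is 1. *)
have stepf x N : Num.min (f x) (N.+1%:R * e) <=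
    e + \sum_(0 <= j < N) e * \1_(K j) x.
  elim: N => [|N IH]; first by rewrite big_geq// addr0 mul1r ge_min lexx orbT.
  rewrite big_nat_recr//= addrA.
  rewrite indicE; case: (boolP (x \in K N)) => [/set_mem|/negP xK].
    move=> xK; rewrite mulr1; move: IH; rewrite -!natr1 !mulrDl !mul1r.
    rewrite /Num.min; do ![case: ifPn]; rewrite -?leNgt; lra.
  have {}xK : f x < N.+1%:R * e.
    by rewrite ltNge; apply/negP => ?; apply: xK; exact/mem_set.
  rewrite mulr0 addr0; apply: le_trans IH.
  by rewrite (min_idPl (ltW xK)) ge_min lexx.
have cg j : continuous (g j).
  have cfj : continuous (fun x => Num.max (f x - j%:R * e) 0).
    move=> x; apply: (@continuous_max R X (fun x => f x - j%:R * e) (cst 0)).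
      by apply: cvgB; [exact: cf|exact: cvg_cst].
    exact: cvg_cst.
  move=> x; apply: (@continuous_min R X _ (cst e)); first exact: cfj.
  exact: cvg_cst.
have mK j : measurable (K j : set (borel X)).
  rewrite (_ : K j = setT `&` f @^-1` `[j.+1%:R * e, +oo[%classic).
    exact: mf.
  by rewrite setTI; apply/seteqP; split => x /=; rewrite in_itv/= andbT.
have muK j : (daniell_borel (K j) <= (e^-1 * L (g j))%:E)%E.
  rewrite -LZ//; apply: daniell_le.
  - by apply: (@cM (cst e^-1)) => //; exact: cst_cont.
  - move=> x; rewrite mulr_ge0// ?invr_ge0 ?(ltW e0)//.
    by rewrite le_min le_max lexx orbT ltW.
  - move=> x /= Kx; rewrite ler_pdivlMl// mulr1 le_min lexx andbT le_max.
    by apply/orP; left; move: Kx; rewrite /K/= -natr1 mulrDl mul1r; lra.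
apply: (@le_trans _ _ (\int[daniell_borel]_x
    (e%:E + \sum_(0 <= j < J) e%:E * (\1_(K j) x)%:E))%E).
  apply: ge0_le_integral => //.
  - by move=> x _; rewrite lee_fin.
  - exact/measurable_EFinP.
  - apply: emeasurable_funD => //; apply: emeasurable_sum => j.
    by apply/measurable_EFinP; apply: measurable_funM => //; exact: measurable_indic.
  - move=> x _; under eq_bigr do rewrite -EFinM; rewrite sumEFin -EFinD lee_fin.
    rewrite (le_trans _ (stepf x J))// le_min lexx/=.
    by rewrite (le_trans (fJ x))// ler_wpM2r ?(ltW e0)// ler_nat.
have e0' : (0 <= e%:E)%E by rewrite lee_fin ltW.
have i0 j x : (0 <= e%:E * (\1_(K j) x)%:E)%E.
  by rewrite mule_ge0// lee_fin.
have mi j : measurable_fun [set: borel X] (fun x => e%:E * (\1_(K j) x)%:E)%E.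
  by apply/measurable_EFinP; apply: measurable_funM => //; exact: measurable_indic.
rewrite ge0_integralD//; last 2 first.
- by move=> x _; apply: sume_ge0.
- exact: emeasurable_sum.
rewrite [X in (X + _)%E](_ : _ = e%:E); last first.
  by rewrite integral_cst// -[RHS]mule1; congr (_ * _)%E; exact: daniell_setT.
rewrite addeC leeD2r//.
rewrite ge0_integral_sum//.
apply: (@le_trans _ _ (\sum_(0 <= j < J) (L (g j))%:E)%E).
  apply: lee_sum => j _; rewrite ge0_integralZl//; last first.
    by apply/measurable_EFinP; exact: measurable_indic.
  rewrite integral_indic// setIT.
  apply: (@le_trans _ _ (e%:E * (e^-1 * L (g j))%:E)%E).
    by apply: lee_wpmul2l.
  by rewrite -EFinM mulrA divff ?gt_eqF// mul1r.
rewrite sumEFin -Lsum// lee_fin; apply: L_le => //; first exact: csum.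
by move=> x; rewrite sumg ge_min lexx.
Qed.

(** As both sides are linear, an upper bound valid for every continuous function is an equality:
    apply it to [-f]. To get the bound for a function of any sign, add a constant [M] that makes it
    nonnegative; both sides grow by [M], since [L] and the measure are normalized. *)
Lemma daniell_Rintegral (f : X -> R) : continuous f ->
  \int[daniell_borel]_x f x = L f.
Proof.
have le (g : X -> R) : continuous g -> \int[daniell_borel]_x g x <= L g.
  move=> cg; have [M gM] := continuous_bounded compactX cg.
  have cM' : continuous (cst M : X -> R) by exact: cst_cont.
  have LM : L (cst M) = M.
    rewrite (_ : cst M = (fun x => M * cst 1 x)) ?LZ ?L1 ?mulr1//.
    by apply/funext => x; rewrite mulr1.
  have g0 x : 0 <= g x + cst M x.
    by have := gM x; rewrite ler_norml/= => /andP[]; lra.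
  have := daniell_integral_le (cD cg cM') g0.
  have igM := continuous_integrable compactX daniell_borel (cD cg cM').
  rewrite -[leLHS]fineK; last exact: integrable_fin_num.
  rewrite lee_fin -/(Rintegral _ _ _) RintegralD//; last 2 first.
  - exact: continuous_integrable.
  - exact: continuous_integrable.
  by rewrite LD// Rintegral_cst// [X in fine X](daniell_setT : _ = _) mulr1 LM lerD2r.
move=> cf; apply/eqP; rewrite eq_le le//=.
have cNf : continuous (fun x => -1 * f x).
  by apply: (@cM (cst (-1))) => //; exact: cst_cont.
have := le _ cNf; rewrite LZ// RintegralZl//; last exact: continuous_integrable.
by rewrite !mulN1r lerN2.
Qed.

End daniell.

Lemma riesz_representation (R : realType) (X : ptopologicalType)
  (L : (X -> R) -> R) : compact [set: X] -> metrizable X R ->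
  (forall f g : X -> R, continuous f -> continuous g ->
    L (fun x => f x + g x) = L f + L g) ->
  (forall (c : R) (f : X -> R), continuous f -> L (fun x => c * f x) = c * L f) ->
  (forall f : X -> R, continuous f -> (forall x, 0 <= f x) -> 0 <= L f) ->
  L (cst 1) = 1 ->
  exists mu : probability (borel X) R,
    forall f : X -> R, continuous f -> \int[mu]_x f x = L f.
Proof.
move=> cX mX LD LZ L0 L1.
exists (daniell_probability cX mX LD LZ L0 L1) => f.
exact: daniell_Rintegral.
Qed.

(** * Borel measures tested on continuous functions: uniqueness, invariance, convex combinations *)

Section borel_measures.
Context (R : realType) (X : ptopologicalType).
Hypothesis compactX : compact [set: X].

(** The open sets are stable under intersection and generate the Borel sets, so agreement on them
    suffices. On an open set both values are limits of the same integrals, by monotone convergence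
    along [open_approximation]. *)
Lemma borel_measure_unique (mu nu : {measure set (borel X) -> \bar R}) :
  metrizable X R -> (mu setT < +oo)%E ->
  (forall f : X -> R, continuous f -> (forall x, 0 <= f x) ->
    (\int[mu]_x (f x)%:E = \int[nu]_x (f x)%:E)%E) ->
  borel_eq mu nu.
Proof.
move=> mX muoo munu.
apply: (@g_sigma_algebra_measure_unique _ _ (borel X) (@open X) _ (fun=> setT)).
- exact: sub_sigma_algebra.
- by move=> _; exact: openT.
- by apply/seteqP; split => // x _; exists 0%N.
- exact: openI.
- move=> U oU; have [h [ch h01 hle _ hU]] := open_approximation mX oU.
  have mU : measurable (U : set (borel X)) by exact: open_borel_measurable.
  have lim_h (m : {measure set (borel X) -> \bar R}) :
      (\int[m]_x (h n x)%:E)%E @[n --> \oo] --> m U.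
    rewrite -[m U](_ : \int[m]_x (limn (fun n => (h n x)%:E)) = _)%E; last first.
      rewrite -[U]setIT -integral_indic//; apply: eq_integral => x _.
      by apply/cvg_lim => //; apply: cvg_EFin; [exact: nearW|exact: hU].
    apply: cvg_monotone_convergence => //.
    - by move=> n; apply/measurable_EFinP; exact: continuous_borel_measurable.
    - by move=> n x _; rewrite lee_fin; have /andP[] := h01 n x.
    - by move=> x _ m' n mn; rewrite lee_fin hle.
  have : (\int[mu]_x (h n x)%:E)%E @[n --> \oo] --> nu U.
    rewrite (_ : (fun n => _) = (fun n => \int[nu]_x (h n x)%:E)%E)//.
    apply/funext => n; apply: munu => // x.
    by have /andP[] := h01 n x.
  by have := lim_h mu; exact: cvg_unique.
- by move=> _.
Qed.

Lemma borel_eq_Rintegral (mu nu : {measure set (borel X) -> \bar R}) (f : X -> R) :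
  borel_eq mu nu -> \int[mu]_x f x = \int[nu]_x f x.
Proof.
by move=> munu; congr fine; apply: eq_measure_integral => A mA _; exact: munu.
Qed.

Lemma finite_measure_unique (mu nu : {finite_measure set (borel X) -> \bar R}) :
  metrizable X R ->
  (forall f : X -> R, continuous f -> \int[mu]_x f x = \int[nu]_x f x) ->
  borel_eq mu nu.
Proof.
move=> mX munu; apply: borel_measure_unique => //.
  by rewrite ltey_eq fin_num_measure.
move=> f cf f0; rewrite -[LHS]fineK ?integrable_fin_num//; last first.
  exact: continuous_integrable.
rewrite -[RHS]fineK ?integrable_fin_num//; last exact: continuous_integrable.
by congr _%:E; exact: munu.
Qed.

Lemma continuous_borel_borel (u : X -> X) : continuous u ->
  measurable_fun [set: borel X] (u : borel X -> borel X).
Proof.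
move=> cu; apply: (@measurability _ _ (borel X) (borel X) setT u (@open X)).
  by [].
move=> _ [U oU <-]; rewrite setTI; apply: open_borel_measurable.
by apply: open_comp => // x _; exact: cu.
Qed.

Section invariant.
Variables (mu : probability (borel X) R) (u : X -> X).
Hypothesis cu : continuous u.

Lemma invariant_Rintegral (f : X -> R) :
  (forall B : set (borel X), measurable B -> mu (u @^-1` B) = mu B) ->
  continuous f -> \int[mu]_x f (u x) = \int[mu]_x f x.
Proof.
move=> mu_u cf; have mu' := continuous_borel_borel cu.
have mf : measurable_fun [set: borel X] (EFin \o f).
  by apply/measurable_EFinP; exact: continuous_borel_measurable.
have ifu : mu.-integrable setT (EFin \o (f \o u)).
  by apply: continuous_integrable => // x; apply: continuous_comp; [exact: cu|exact: cf].
congr fine; have H := integral_pushforward mu' mf ifu measurableT.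
etransitivity; first exact: (esym H).
by apply/eq_measure_integral => // A mA _; exact: mu_u.
Qed.

(** Invariance says that [mu] equals its pushforward along [u], and the hypothesis says that these
    two measures have the same integrals. *)
Lemma Rintegral_invariant : metrizable X R ->
  (forall f : X -> R, continuous f -> \int[mu]_x f (u x) = \int[mu]_x f x) ->
  forall B : set (borel X), measurable B -> mu (u @^-1` B) = mu B.
Proof.
move=> mX mu_u B mB; have mu' := continuous_borel_borel cu.
pose nu : {measure set (borel X) -> \bar R} :=
  measure_function_pushforward__canonical__measure_function_Measure mu mu'.
suff : borel_eq mu nu by move/(_ _ mB).
apply: borel_measure_unique => //; first by rewrite ltey_eq fin_num_measure.
move=> f cf f0; have mf : measurable_fun [set: borel X] (EFin \o f).
  by apply/measurable_EFinP; exact: continuous_borel_measurable.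
transitivity (\int[mu]_x (f (u x))%:E)%E; last first.
  by apply/esym/(ge0_integral_pushforward mu' mu) => // x _; rewrite lee_fin.
rewrite -[LHS]fineK ?integrable_fin_num//; last exact: continuous_integrable.
rewrite -[RHS]fineK ?integrable_fin_num//; last first.
  by apply: continuous_integrable => // x; apply: continuous_comp; [exact: cu|exact: cf].
by congr _%:E; rewrite -/(Rintegral _ _ _) -mu_u.
Qed.

End invariant.

Lemma probability_Rintegral_cst (mu : probability (borel X) R) (c : R) :
  \int[mu]_x c = c.
Proof.
rewrite Rintegral_cst// -[RHS]mulr1; congr (_ * _).
by rewrite [X in fine X](probability_setT mu).
Qed.

(** For nonnegative functions this is additivity of the integral in the measure. The general case
    follows by adding a constant [M], which cancels because all three measures are probabilities and
    the weights sum to 1. *)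
Lemma prob_conv_Rintegral (t : R) (t01 : 0 <= t <= 1) (mu nu : probability (borel X) R)
    (f : X -> R) : continuous f ->
  \int[prob_conv t01 mu nu]_x f x = t * \int[mu]_x f x + (1 - t) * \int[nu]_x f x.
Proof.
have shift (u v w M : R) : w + M = t * (u + M) + (1 - t) * (v + M) ->
    w = t * u + (1 - t) * v.
  by move/(canRL (addrK _)) ->; ring.
have ge0 (g : X -> R) : continuous g -> (forall x, 0 <= g x) ->
    \int[prob_conv t01 mu nu]_x g x =
    t * \int[mu]_x g x + (1 - t) * \int[nu]_x g x.
  move=> cg g0; have mg : measurable_fun [set: borel X] (EFin \o g).
    by apply/measurable_EFinP; exact: continuous_borel_measurable.
  have fin (m : probability (borel X) R) : (\int[m]_x (g x)%:E)%E \is a fin_num.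
    by apply: integrable_fin_num => //; exact: continuous_integrable.
  rewrite /Rintegral ge0_integral_measure_add//; last by move=> x _; rewrite lee_fin.
  rewrite !ge0_integral_mscale//=; try by move=> x _; rewrite lee_fin.
  by rewrite -(fineK (fin mu)) -(fineK (fin nu)) -!EFinM -EFinD.
move=> cf; have [M fM] := continuous_bounded compactX cf.
have cM : continuous (cst M : X -> R) by move=> x; exact: cvg_cst.
have cfM : continuous (fun x => f x + M).
  by move=> x; apply: cvgD; [exact: cf|exact: cvg_cst].
have := ge0 _ cfM; rewrite !RintegralD//; try exact: continuous_integrable.
rewrite !probability_Rintegral_cst => H.
have {}/H : forall x, 0 <= f x + M.
  by move=> x; have := fM x; rewrite ler_norml => /andP[]; lra.
exact: shift.
Qed.

End borel_measures.

(** * Complex-valued continuous functions *)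

Section complex_modulus.
Context (R : realType).
Implicit Types (z w : Cx R) (r : R).

Lemma rnormE_sqrt z :
  rnorm z = Num.sqrt (complex.Re z ^+ 2 + complex.Im z ^+ 2).
Proof. by rewrite /rnorm normc_def. Qed.

Lemma rnorm_real r : rnorm (real_complex R r : Cx R) = `|r|.
Proof. by rewrite rnormE_sqrt/= expr0n/= addr0 sqrtr_sqr. Qed.

Lemma norm_Re_le z : `|complex.Re z| <= rnorm z.
Proof.
rewrite rnormE_sqrt -sqrtr_sqr ler_sqrt; last by rewrite addr_ge0// sqr_ge0.
by rewrite lerDl sqr_ge0.
Qed.

Lemma norm_Im_le z : `|complex.Im z| <= rnorm z.
Proof.
rewrite rnormE_sqrt -sqrtr_sqr ler_sqrt; last by rewrite addr_ge0// sqr_ge0.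
by rewrite lerDr sqr_ge0.
Qed.

Lemma rnorm_sqr z : rnorm z ^+ 2 = complex.Re z ^+ 2 + complex.Im z ^+ 2.
Proof. by rewrite rnormE_sqrt sqr_sqrtr// addr_ge0// sqr_ge0. Qed.

Lemma real_complexM r z :
  real_complex R r * z = Complex (r * complex.Re z) (r * complex.Im z) :> Cx R.
Proof.
by case: z => u v; apply/eqP; rewrite eq_complex/=; apply/andP; split; apply/eqP; ring.
Qed.

End complex_modulus.

Section continuous_complex.
Context (R : realType) (X : topologicalType).

Lemma continuous_Re (f : X -> Cx R) : continuous f ->
  continuous (fun x => complex.Re (f x)).
Proof.
move=> cf x; apply/cvgrPdist_lt => e e0.
have /cvgrPdist_lt/(_ (real_complex R e)) := cf x.
rewrite ltcR => /(_ e0); apply: filterS => y.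
rewrite rnormE ltcR.
apply: le_lt_trans; rewrite (_ : _ - _ = complex.Re (f x - f y)) ?norm_Re_le//.
by case: (f x) => ? ?; case: (f y).
Qed.

Lemma continuous_Im (f : X -> Cx R) : continuous f ->
  continuous (fun x => complex.Im (f x)).
Proof.
move=> cf x; apply/cvgrPdist_lt => e e0.
have /cvgrPdist_lt/(_ (real_complex R e)) := cf x.
rewrite ltcR => /(_ e0); apply: filterS => y.
rewrite rnormE ltcR.
apply: le_lt_trans; rewrite (_ : _ - _ = complex.Im (f x - f y)) ?norm_Im_le//.
by case: (f x) => ? ?; case: (f y).
Qed.

Lemma continuous_real_complex (f : X -> R) : continuous f ->
  continuous (fun x => real_complex R (f x) : Cx R).
Proof.
move=> cf x; apply/cvgrPdist_lt => e e0.
(* A positive element of [Cx R] has zero imaginary part. *)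
have e0' : e = real_complex R (complex.Re e).
  by case: e e0 => u v; rewrite ltcE/= => /andP[/eqP-> _].
have /cvgrPdist_lt/(_ (complex.Re e)) := cf x.
rewrite -ltcR -e0' => /(_ e0); apply: filterS => y.
rewrite rnormE e0' ltcR.
by rewrite -rmorphB rnorm_real.
Qed.

End continuous_complex.

(* locked, for unification would otherwise unfold [insubd] *)
HB.lock Definition rcont (R : realType) (X : topologicalType) (h : X -> R) :
  contfun R X := insubd (0 : contfun R X) (fun x => real_complex R (h x) : Cx R).

Section contfun.
Context (R : realType) (X : topologicalType).

Lemma rcontE (h : X -> R) x : continuous h -> rcont h x = real_complex R (h x).
Proof.
move=> ch; rewrite rcont.unlock insubdK//.
by apply/cont_predP; exact: continuous_real_complex.
Qed.

Lemma contfun_eqP (f k : contfun R X) : (forall x, f x = k x) -> f = k.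
Proof. by move=> fk; apply: val_inj; apply/funext. Qed.

Lemma contfun_continuous (f : contfun R X) : continuous f.
Proof. exact/cont_predP/contfunP. Qed.

Lemma contfunDE (f k : contfun R X) x : (f + k) x = f x + k x.
Proof. by []. Qed.

Lemma contfunNE (f : contfun R X) x : (- f) x = - f x.
Proof. by []. Qed.

Lemma contfunME (f k : contfun R X) x : (f * k) x = f x * k x.
Proof. by []. Qed.

Lemma contfunZE (c : Cx R) (f : contfun R X) x : (c *: f) x = c * f x.
Proof. by []. Qed.

Lemma contfun1E x : (1 : contfun R X) x = 1.
Proof. by []. Qed.

Lemma rcontD (h k : X -> R) : continuous h -> continuous k ->
  rcont (fun x => h x + k x) = rcont h + rcont k.
Proof.
move=> ch ck; apply: contfun_eqP => x.
have chk : continuous (fun x => h x + k x).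
  by move=> y; apply: cvgD; [exact: ch|exact: ck].
rewrite (rcontE x chk) contfunDE [X in _ = X + _](rcontE x ch).
by rewrite [X in _ = _ + X](rcontE x ck) rmorphD.
Qed.

Lemma rcontZ (c : R) (h : X -> R) : continuous h ->
  rcont (fun x => c * h x) = (real_complex R c : Cx R) *: rcont h.
Proof.
move=> ch; apply: contfun_eqP => x.
have cch : continuous (fun x => c * h x).
  by move=> y; apply: cvgM; [exact: cvg_cst|exact: ch].
by rewrite (rcontE x cch) contfunZE [X in _ = _ * X](rcontE x ch) rmorphM.
Qed.

Lemma rcont1 : rcont (cst 1 : X -> R) = 1 :> contfun R X.
Proof.
have c1 : continuous (cst 1 : X -> R) by move=> y; exact: cvg_cst.
by apply: contfun_eqP => x; rewrite (rcontE x c1).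
Qed.

Lemma contfun_ReIm (f : contfun R X) :
  f = rcont (fun x => complex.Re (f x)) +
      (Complex 0 1 : Cx R) *: rcont (fun x => complex.Im (f x)).
Proof.
have cf := @contfun_continuous f.
apply: contfun_eqP => x; rewrite contfunDE contfunZE.
rewrite [X in _ = X + _](rcontE x (continuous_Re cf)).
rewrite [X in _ = _ + _ * X](rcontE x (continuous_Im cf)).
by case: (f x) => u v; apply/eqP; rewrite eq_complex/=; apply/andP; split; apply/eqP; ring.
Qed.

End contfun.

Section supnorm.
Context (R : realType) (X : ptopologicalType).
Hypothesis compactX : compact [set: X].
Implicit Types f : contfun R X.

Lemma rnorm_le_supnorm f x : rnorm (f x) <= supnorm f.
Proof.
have cf := @contfun_continuous _ _ f.
have [M1 H1] := continuous_bounded compactX (continuous_Re cf).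
have [M2 H2] := continuous_bounded compactX (continuous_Im cf).
apply: ub_le_sup; last by exists x.
(* A real [sup] is meaningful only for a bounded set. The sum of bounds for the real and imaginary
   parts bounds the modulus. *)
exists (M1 + M2) => _ [y _ <-].
rewrite -[leLHS]ger0_norm ?rnorm_ge0// -ler_sqr ?nnegrE//; last first.
  by rewrite addr_ge0//; [exact: le_trans (H1 y)|exact: le_trans (H2 y)].
rewrite real_normK ?num_real// rnorm_sqr.
have := H1 y; have := H2 y.
rewrite -(real_normK (num_real (complex.Re (f y)))).
rewrite -(real_normK (num_real (complex.Im (f y)))).
have := normr_ge0 (complex.Re (f y)); have := normr_ge0 (complex.Im (f y)).
by nra.
Qed.

Lemma supnorm_le f M : (forall x, rnorm (f x) <= M) -> supnorm f <= M.
Proof.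
move=> fM; apply: ge_sup => [|_ [x _ <-]//].
by exists (rnorm (f point)); exists point.
Qed.

Lemma supnorm_ge0 f : 0 <= supnorm f.
Proof. by rewrite (le_trans _ (rnorm_le_supnorm f point))// rnorm_ge0. Qed.

End supnorm.

Section cintegral.
Context (R : realType) (X : ptopologicalType).
Hypothesis compactX : compact [set: X].
Implicit Types f : contfun R X.

Lemma cintegral_linear (mu : {finite_measure set (borel X) -> \bar R})
    (c : Cx R) f k :
  cintegral mu (c *: f + k : contfun R X) = c * cintegral mu f + cintegral mu k.
Proof.
have cre g := continuous_Re (@contfun_continuous R X g).
have cim g := continuous_Im (@contfun_continuous R X g).
have iZ (r : R) (h : X -> R) : continuous h ->
    mu.-integrable setT (EFin \o (fun x => r * h x)).
  move=> ch; apply: continuous_integrable => // x.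
  by apply: cvgM; [exact: cvg_cst|exact: ch].
have iB (r s : R) (h1 h2 : X -> R) : continuous h1 -> continuous h2 ->
    mu.-integrable setT (EFin \o (fun x => r * h1 x + s * h2 x)).
  move=> ch1 ch2; apply: continuous_integrable => // x.
  by apply: cvgD; apply: cvgM; (try exact: cvg_cst); [exact: ch1|exact: ch2].
have icts h : continuous h -> mu.-integrable setT (EFin \o h).
  exact: continuous_integrable.
case: c => r s; rewrite /cintegral.
rewrite (_ : (fun x => complex.Re _) = (fun x => (r * complex.Re (f x) +
   (- s) * complex.Im (f x)) + complex.Re (k x))); last first.
  apply/funext => x; rewrite contfunDE contfunZE.
  by case: (f x) => ? ?; case: (k x) => ? ? /=; ring.
rewrite (_ : (fun x => complex.Im _) = (fun x => (r * complex.Im (f x) +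
   s * complex.Re (f x)) + complex.Im (k x))); last first.
  apply/funext => x; rewrite contfunDE contfunZE.
  by case: (f x) => ? ?; case: (k x) => ? ? /=; ring.
rewrite !RintegralD ?RintegralZl//; try by [exact: iB|exact: iZ|exact: icts].
by apply/eqP; rewrite eq_complex/=; apply/andP; split; apply/eqP; ring.
Qed.

(** Multiplying [f] by the conjugate [w] of its integral [z] turns the integral into the real number
    [|z|^2]. Only the real part of [w * f] then has to be estimated, by [|z| * supnorm f], and one
    factor [|z|] cancels. *)
Lemma cintegral_le (mu : probability (borel X) R) f :
  rnorm (cintegral mu f) <= supnorm f.
Proof.
set z := cintegral mu f.
have [z0|z0] := eqVneq (rnorm z) 0; first by rewrite z0 supnorm_ge0.
have zp : 0 < rnorm z by rewrite lt_def z0 rnorm_ge0.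
pose w : Cx R := Complex (complex.Re z) (- complex.Im z).
have wz : rnorm w = rnorm z by rewrite !rnormE_sqrt/= sqrrN.
have wf x : complex.Re (w * f x) <= rnorm z * supnorm f.
  rewrite (le_trans (ler_norm _))// (le_trans (norm_Re_le _))//.
  by rewrite rnormM wz ler_wpM2l ?rnorm_ge0// rnorm_le_supnorm.
have c0 : cintegral mu (0 : contfun R X) = 0.
  have := cintegral_linear mu (-1) 0 (0 : contfun R X).
  by rewrite scaler0 addr0 mulN1r addNr.
have wfE : cintegral mu (w *: f : contfun R X) = w * z.
  by have := cintegral_linear mu w f 0; rewrite !addr0 c0 addr0.
have : complex.Re (cintegral mu (w *: f : contfun R X)) <= rnorm z * supnorm f.
  rewrite /cintegral/= -(probability_Rintegral_cst mu (_ * _)).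
  apply: le_Rintegral => //.
  - apply: continuous_integrable => //; apply: continuous_Re.
    exact: (@contfun_continuous R X (w *: f)).
  - by apply: continuous_integrable => // x; exact: cvg_cst.
  - by move=> x _; exact: wf.
have wzE : complex.Re (w * z) = rnorm z ^+ 2.
  by rewrite rnorm_sqr /w; case: (z) => a b /=; ring.
by rewrite wfE wzE expr2 ler_pM2l.
Qed.

Lemma cintegral1 (mu : probability (borel X) R) :
  cintegral mu (1 : contfun R X) = 1.
Proof. by rewrite /cintegral/= !probability_Rintegral_cst. Qed.

Lemma cintegral_rcont (mu : {measure set (borel X) -> \bar R}) (h : X -> R) :
  continuous h -> cintegral mu (rcont h) = real_complex R (\int[mu]_x h x).
Proof.
move=> ch; rewrite /cintegral.
have -> : (fun x => complex.Re (rcont h x)) = h.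
  by apply/funext => x; rewrite rcontE.
have -> : (fun x => complex.Im (rcont h x)) = cst 0.
  by apply/funext => x; rewrite rcontE.
by rewrite [X in Complex _ X](_ : _ = 0)// /Rintegral integral0.
Qed.

(* A norm-one unital functional on [C(X)] is positive: comparing with
   [f + i t] for all real [t] shows that it is real on real [f], and comparing
   with [M - f] that it is positive. *)
Lemma complex_riesz (phi : contfun R X -> Cx R) : metrizable X R ->
  (forall c f k, phi (c *: f + k) = c * phi f + phi k) -> phi 1 = 1 ->
  (forall f, rnorm (phi f) <= supnorm f) ->
  exists mu : probability (borel X) R, forall f, phi f = cintegral mu f.
Proof.
move=> mX phiL phi1 phi_le.
have phi0 : phi 0 = 0.
  by have := phiL (-1) 0 0; rewrite scaler0 addr0 mulN1r addNr.
have phiZ c f : phi (c *: f) = c * phi f by rewrite -[_ *: _]addr0 phiL phi0 addr0.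
have phiD f k : phi (f + k) = phi f + phi k.
  by rewrite -[f in LHS]scale1r phiL mul1r.
have phi_im (h : X -> R) : continuous h -> complex.Im (phi (rcont h)) = 0.
  move=> ch; have [M hM] := continuous_bounded compactX ch.
  set b := complex.Im _.
  have bt (t : R) : (b + t) ^+ 2 <= M ^+ 2 + t ^+ 2.
    have := phi_le ((Complex 0 t : Cx R) *: (1 : contfun R X) + rcont h).
    rewrite phiL phi1 mulr1 => ht.
    have {}ht : rnorm ((Complex 0 t : Cx R) + phi (rcont h)) <=
        Num.sqrt (M ^+ 2 + t ^+ 2).
      apply: (le_trans ht); apply: supnorm_le => // x.
      rewrite contfunDE contfunZE contfun1E mulr1 rcontE// rnormE_sqrt/=.
      rewrite ler_wsqrtr// add0r addr0 lerD2r.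
      by rewrite -(real_normK (num_real (h x))) lerXn2r// nnegrE (le_trans _ (hM x)).
    have : `|b + t| <= Num.sqrt (M ^+ 2 + t ^+ 2).
      apply: le_trans ht; apply: le_trans (norm_Im_le _).
      by rewrite /b; case: (phi _) => u v /=; rewrite addrC.
    rewrite -ler_sqr ?nnegrE ?sqrtr_ge0// real_normK ?num_real// sqr_sqrtr//.
    by rewrite addr_ge0// sqr_ge0.
  apply/eqP; apply: contraT => b0.
  (* This [t] makes the cross term [2 * b * t] equal to [M ^+ 2 + 1], more than [bt] allows. *)
  have := bt ((M ^+ 2 + 1) / (2 * b)).
  have -> : (b + (M ^+ 2 + 1) / (2 * b)) ^+ 2 =
      b ^+ 2 + (M ^+ 2 + 1) + ((M ^+ 2 + 1) / (2 * b)) ^+ 2 by field.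
  by rewrite lerD2r; have := sqr_ge0 b; lra.
have ReD (z w : Cx R) : complex.Re (z + w) = complex.Re z + complex.Re w.
  by case: z w => ? ? [].
pose L (h : X -> R) := complex.Re (phi (rcont h)).
have phiE h : continuous h -> phi (rcont h) = real_complex R (L h).
  move=> ch; have := phi_im _ ch; rewrite /L.
  by case: (phi _) => u v /= ->.
have [mu muL] : exists mu : probability (borel X) R,
    forall f : X -> R, continuous f -> \int[mu]_x f x = L f.
  apply: riesz_representation => //.
  - by move=> f k cf ck; rewrite /L (rcontD cf ck) phiD ReD.
  - by move=> c f cf; rewrite /L (rcontZ c cf) phiZ real_complexM.
  - move=> f cf f0; have [M fM] := continuous_bounded compactX cf.
    have : `|M - L f| <= M.
      rewrite -rnorm_real rmorphB/= -phiE//.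
      have -> : (real_complex R M : Cx R) - phi (rcont f) =
          phi ((-1) *: rcont f + (real_complex R M : Cx R) *: (1 : contfun R X)).
        by rewrite phiL phiZ phi1 mulr1 mulN1r addrC.
      apply: (le_trans (phi_le _)); apply: supnorm_le => // x.
      rewrite contfunDE !contfunZE contfun1E mulr1 rcontE// mulN1r addrC.
      rewrite -rmorphB rnorm_real.
      have fxM : f x <= M := le_trans (ler_norm _) (fM x).
      by rewrite ger0_norm ?subr_ge0// gerBl.
    by rewrite ler_norml => /andP[_]; lra.
  - by rewrite /L rcont1 phi1.
exists mu => f; rewrite {1}[f]contfun_ReIm addrC phiL.
have cre := continuous_Re (@contfun_continuous _ _ f).
have cim := continuous_Im (@contfun_continuous _ _ f).
rewrite (phiE _ cre) (phiE _ cim) -(muL _ cre) -(muL _ cim) /cintegral.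
by apply/eqP; rewrite eq_complex/=; apply/andP; split; apply/eqP; ring.
Qed.

End cintegral.

(** * Traces on the reduced crossed product *)

Section Cc_theory.
Context (R : realType) (G : groupType) (X : topologicalType).
Variable a : gspace G X.
Local Notation C := (Cx R).
Local Notation CX := (contfun R X).
Local Notation Cc := (Cc R G X).
Implicit Types (f k : CX) (g h : G) (x y : Cc).

Lemma Cc_eqP x y : (forall g, x g = y g) -> x = y.
Proof. by move=> xy; apply: val_inj; apply/funext. Qed.

Lemma CcDE x y g : (x + y) g = x g + y g.
Proof. by []. Qed.

Lemma CcZE (c : C) x g : (c *: x) g = c *: x g.
Proof. by []. Qed.

Lemma Cc_singleE f g h : Cc_single f g h = if h == g then f else 0.
Proof. by []. Qed.

Lemma Cc_sumE (s : seq G) (F : G -> Cc) g :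
  (\sum_(i <- s) F i) g = \sum_(i <- s) F i g.
Proof. by elim: s => [|i s IH]; rewrite ?big_nil// !big_cons CcDE IH. Qed.

Lemma Cc_ind (P : Cc -> Prop) :
  (forall x y, P x -> P y -> P (x + y)) -> (forall f g, P (Cc_single f g)) ->
  forall x, P x.
Proof.
move=> PD P1 x; have /fsupp_predP/finite_seqP[s sE] := CcP x.
have -> : x = \sum_(g <- undup s) Cc_single (x g) g.
  apply: Cc_eqP => h; rewrite Cc_sumE.
  have [hs|hs] := boolP (h \in undup s).
    rewrite (bigD1_seq h) ?undup_uniq//= eqxx big1 ?addr0// => g gh.
    by rewrite eq_sym (negbTE gh).
  rewrite big_seq big1 => [|g gs]; last first.
    by rewrite Cc_singleE; case: eqP => // hg; rewrite hg gs in hs.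
  apply/eqP; apply: contraNT hs => xh; rewrite mem_undup.
  by have : [set g | x g != 0] h by []; rewrite sE.
apply: big_ind => //.
(* The empty sum is itself a single term, so the induction has only two cases. *)
have -> : (0 : Cc) = Cc_single (0 : CX) 1%g.
  by apply: Cc_eqP => h; rewrite Cc_singleE; case: ifP.
exact: P1.
Qed.

Lemma Cc_singleD f k g : Cc_single (f + k) g = Cc_single f g + Cc_single k g.
Proof.
apply: Cc_eqP => h; rewrite CcDE !Cc_singleE; case: ifP => // _.
by rewrite addr0.
Qed.

Lemma Cc_singleZ (c : C) f g : Cc_single (c *: f) g = c *: Cc_single f g.
Proof.
apply: Cc_eqP => h; rewrite CcZE !Cc_singleE; case: ifP => // _.
by rewrite scaler0.
Qed.

Lemma translateE g f z : translate a g f z = f (a g^-1%g z).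
Proof. by []. Qed.

Lemma translate1 f : translate a 1%g f = f.
Proof. by apply: contfun_eqP => z; rewrite translateE invg1 act1. Qed.

Lemma translateM g h f : translate a g (translate a h f) = translate a (g * h)%g f.
Proof. by apply: contfun_eqP => z; rewrite !translateE invgM actM. Qed.

Lemma translate0 g : translate a g (0 : CX) = 0.
Proof. exact: contfun_eqP. Qed.

Lemma translate_1 g : translate a g (1 : CX) = 1.
Proof. exact: contfun_eqP. Qed.

Lemma Cc_mul_single f g k h :
  Cc_mul a (Cc_single f g) (Cc_single k h) =
  Cc_single (f * translate a g k) (g * h)%g.
Proof.
apply: Cc_eqP => u; rewrite /Cc_mul/=.
rewrite -(fsbig_widen [set g] setT)//=; last first.
  by move=> v [_ /eqP/negbTE vg] /=; rewrite vg mul0r.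
rewrite fsbig_set1 eqxx.
have -> : (g^-1 * u == h)%g = (u == g * h)%g.
  by apply/eqP/eqP => [<-|->]; rewrite ?mulVKg ?mulKg.
by case: ifP => // _; rewrite translate0 mulr0.
Qed.

End Cc_theory.

(** * Operator norms and the norm of [f u_1] *)

Lemma opnorm_le (R : realType) (V W : lmodType (Cx R)) (nV : V -> \bar R)
    (nW : W -> \bar R) (T : V -> W) (M : R) :
  (forall c v, T (c *: v) = c *: T v) ->
  (forall c v, nV (c *: v) = ((rnorm c)%:E * nV v)%E) ->
  (forall c w, nW (c *: w) = ((rnorm c)%:E * nW w)%E) ->
  (forall v, nV v \is a fin_num) -> (forall v, 0 <= nV v)%E ->
  (forall w, 0 <= nW w)%E ->
  (opnorm nV nW T <= M%:E)%E -> forall v, (nW (T v) <= M%:E * nV v)%E.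
Proof.
move=> TZ nVZ nWZ nVfin nV0 nW0 TM v.
have nTM u : (nV u <= 1)%E -> (nW (T u) <= M%:E)%E.
  by move=> u1; apply: le_trans TM; apply: ereal_sup_ubound; exists u.
have M0 : 0 <= M.
  rewrite -lee_fin; apply: le_trans (nTM 0 _) => //.
  by rewrite -(scale0r 0) nVZ /rnorm normr0 mul0e.
pose x := fine (nV v); have xE : nV v = x%:E by rewrite fineK.
have x0 : 0 <= x by rewrite -lee_fin -xE.
rewrite xE -EFinM; apply/lee_addgt0Pr => e e0.
(* Scaling by slightly more than the norm keeps the factor positive even when [v] has norm 0. The
   slack costs [M * e / (M + 1)], at most [e]. *)
pose s := x + e / (M + 1).
have M1 : 0 < M + 1 by rewrite ltr_wpDl.
have s0 : 0 < s by rewrite ltr_wpDl// divr_gt0.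
have sinv : (real_complex R s : Cx R) * real_complex R s^-1 = 1.
  by rewrite -rmorphM divff ?gt_eqF// rmorph1.
rewrite -[v](scale1r v) -sinv -scalerA TZ nWZ rnorm_real gtr0_norm//.
apply: (@le_trans _ _ (s%:E * M%:E)%E).
  rewrite lee_wpmul2l ?lee_fin ?(ltW s0)//; apply: nTM.
  rewrite nVZ rnorm_real gtr0_norm ?invr_gt0// xE -EFinM lee_fin.
  by rewrite ler_pdivrMl// mulr1 /s lerDl divr_ge0// ltW.
rewrite -EFinM -EFinD lee_fin /s mulrDl mulrC lerD2l.
by rewrite mulrAC ler_pdivrMr// ler_wpM2l ?(ltW e0)// lerDl.
Qed.

Section Lp_norm.
Context d (Y : measurableType d) (R : realType).
Variables (lambda : {measure set Y -> \bar R}) (p : R) (p1 : 1 <= p).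
Local Notation LpY := (Lp lambda p1).

Let p0 : 0 < p. Proof. exact: lt_le_trans p1. Qed.

Lemma Lp_normZ (c : Cx R) (u : LpY) :
  Lp_norm (c *: u) = ((rnorm c)%:E * Lp_norm u)%E.
Proof.
have fm : measurable_fun setT (fun y => `|(rnorm (repr u y))%:E| `^ p)%E.
  apply: measurable_powp; apply: measurable_rnorm.
  by have /Lp_predP[] := Lp_funP (repr u).
rewrite -[c *: u]/(Lp_class (c *: repr u)) Lp_normE /Lp_norm unlock.
rewrite (_ : (fun y => _) =
    (fun y => (rnorm c)%:E `^ p * `|(rnorm (repr u y))%:E| `^ p)%E); last first.
  apply/funext => y; rewrite -[X in rnorm X]/(c * repr u y) rnormM.
  by rewrite EFinM abseM poweRM// gee0_abs// lee_fin rnorm_ge0.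
rewrite ge0_integralZl ?poweR_ge0//; last by move=> y _; exact: poweR_ge0.
rewrite poweRM ?poweR_ge0//; last by apply: integral_ge0 => y _; exact: poweR_ge0.
by rewrite -poweRrM divff ?gt_eqF// poweRe1// lee_fin rnorm_ge0.
Qed.

Lemma Lp_norm_fin (u : LpY) : Lp_norm u \is a fin_num.
Proof.
rewrite ge0_fin_numE ?Lnorm_ge0//.
have /Lp_predP[_] := Lp_funP (repr u).
by rewrite inE => /andP[_]; rewrite inE.
Qed.

Lemma Lp_norm_ge0 (u : LpY) : (0 <= Lp_norm u)%E.
Proof. exact: Lnorm_ge0. Qed.

End Lp_norm.

(** The norm bound for diagonal operators on l^p(G, V), in the unit-ball form in which [opnorm] asks
    for it. *)
Lemma ell_norm_le (R : realType) (p : R) (G : groupType) (V : Type)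
    (nV : V -> \bar R) (M : R) (xi eta : G -> V) : 1 <= p -> 0 <= M ->
  (forall v, 0 <= nV v)%E ->
  (forall h, nV (eta h) <= M%:E * nV (xi h))%E ->
  (ell_norm p nV xi <= 1)%E -> (ell_norm p nV eta <= M%:E)%E.
Proof.
move=> p1 M0 nV0 etaxi xi1; have p0 : 0 < p by exact: lt_le_trans p1.
have M0' : (0 <= M%:E)%E by rewrite lee_fin.
have in0 (x : \bar R) : (0 <= x)%E -> x \in `[0%E, +oo%E].
  by move=> x0; rewrite in_itv/= x0 leey.
set S := (\esum_(h in [set: G]) (nV (xi h) `^ p)%E)%E in xi1.
have S0 : (0 <= S)%E by apply: esum_ge0 => h _; exact: poweR_ge0.
have S1 : (S <= 1)%E.
  have -> : S = ((S `^ p^-1) `^ p)%E by rewrite -poweRrM mulVf ?gt_eqF// poweRe1.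
  rewrite -[leRHS](_ : 1 `^ p = 1)%E; last by rewrite poweR_EFin powR1.
 apply: gt0_ler_poweR => //; first exact: ltW.
  - by apply: in0; exact: poweR_ge0.
  - exact: in0.
have -> : M%:E = ((M%:E `^ p) `^ p^-1)%E by rewrite -poweRrM divff ?gt_eqF// poweRe1.
apply: gt0_ler_poweR; rewrite ?invr_ge0 ?(ltW p0)//.
- by apply: in0; apply: esum_ge0 => h _; exact: poweR_ge0.
- by apply: in0; exact: poweR_ge0.
apply: ge_ereal_sup => _ [F [finF _] <-].
apply: (@le_trans _ _ (\sum_(h \in F) (M%:E `^ p * nV (xi h) `^ p))%E).
  apply: lee_fsum => // h _; rewrite -poweRM//; apply: gt0_ler_poweR => //.
  - exact: ltW.
  - exact: in0.
  - by apply: in0; exact: mule_ge0.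
rewrite -ge0_mule_fsumr => [|h]; last exact: poweR_ge0.
rewrite -[leRHS]mule1 lee_wpmul2l ?poweR_ge0//.
by apply: le_trans S1; apply: esum_ge; exists F.
Qed.

Section norm_single.
Context (R : realType) (p : R) (G : groupType) (X : ptopologicalType).
Variables (p1 : 1 <= p) (a : gspace G X).
Hypothesis compactX : compact [set: X].

Lemma integrated_form_single d (Y : measurableType d)
    (lambda : {measure set Y -> \bar R})
    (pi0 : contfun R X -> Lp lambda p1 -> Lp lambda p1) (f : contfun R X)
    (xi : G -> Lp lambda p1) :
  contractive_representation pi0 ->
  integrated_form a pi0 (Cc_single f 1%g) xi =
  (fun h => pi0 (translate a h^-1%g f) (xi h)).
Proof.
move=> [_ piL _ _].
have pi00 u : pi0 0 u = 0.
  have := piL (-1) 0 0 u; rewrite scaler0 addr0 scaleN1r => ->.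
  by rewrite addNr.
rewrite /integrated_form -(fsbig_widen [set 1%g] setT)//=; last first.
  move=> g [_ /eqP/negbTE g1] /=; rewrite g1.
  by apply/funext => h; rewrite /reg_pi translate0 pi00.
rewrite fsbig_set1 eqxx; apply/funext => h.
by rewrite /reg_pi /reg_v invg1 mul1g.
Qed.

(** In every regular representation [v_1] is the identity, so [f u_1] acts diagonally, with entries
    [pi0] of translates of [f]. Translation does not increase the supremum norm and [pi0] is
    contractive. *)
Lemma reduced_seminorm_single (f : contfun R X) :
  (reduced_seminorm p1 a (Cc_single f 1%g) <= (supnorm f)%:E)%E.
Proof.
apply: ge_ereal_sup => _ [d [Y [lambda [pi0 [_ cpi _ ->]]]]].
apply: ge_ereal_sup => _ [xi /= xi1 <-].
rewrite (integrated_form_single _ _ cpi).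
apply: ell_norm_le xi1 => //; first exact: supnorm_ge0.
  exact: Lp_norm_ge0.
move=> h; have [piT _ _ pile] := cpi.
have tf : supnorm (translate a h^-1%g f) <= supnorm f.
  by apply: supnorm_le => // x; rewrite translateE; exact: rnorm_le_supnorm.
apply: (@opnorm_le _ _ _ _ _ (pi0 (translate a h^-1%g f))).
- move=> c u; have := piT (translate a h^-1%g f) c u 0.
  have -> : pi0 (translate a h^-1%g f) 0 = 0.
    have := piT (translate a h^-1%g f) (-1) 0 0.
    by rewrite scaler0 addr0 scaleN1r => ->; rewrite addNr.
  by rewrite !addr0.
- exact: Lp_normZ.
- exact: Lp_normZ.
- exact: Lp_norm_fin.
- exact: Lp_norm_ge0.
- exact: Lp_norm_ge0.
- by apply: (le_trans (pile _)); rewrite lee_fin.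
Qed.

End norm_single.

(** * Bounded functionals and density *)

Section banach_algebra.
Context (R : realType) (A : banachAlgType (Cx R)).
Local Notation C := (Cx R).

Lemma rnormZ (c : C) (x : A) : rnorm (c *: x) = rnorm c * rnorm x.
Proof.
by have := normrZ c x; rewrite !rnormE -rmorphM => /(congr1 (@complex.Re R)).
Qed.

Lemma rnorm_bmul (x y : A) : rnorm (bmul x y) <= rnorm x * rnorm y.
Proof. by have := bmul_norm x y; rewrite !rnormE -rmorphM lecR. Qed.

Lemma bmulDl (x y z : A) : bmul (x + y) z = bmul x z + bmul y z.
Proof. by have := bmul_linearl z 1 x y; rewrite !scale1r. Qed.

Lemma bmulDr (x y z : A) : bmul x (y + z) = bmul x y + bmul x z.
Proof. by have := bmul_linearr x 1 y z; rewrite !scale1r. Qed.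

Definition bounded_functional (T : A -> C) := linear T /\
  exists M : R, forall x, rnorm (T x) <= M * rnorm x.

Lemma linear_add (V W : lmodType C) (T : V -> W) : linear T ->
  forall x y, T (x + y) = T x + T y.
Proof. by move=> TL x y; have := TL 1 x y; rewrite !scale1r. Qed.

Lemma linear_zero (V W : lmodType C) (T : V -> W) : linear T -> T 0 = 0.
Proof.
by move=> TL; have := TL (-1) 0 0; rewrite scaler0 addr0 scaleN1r addNr.
Qed.

Lemma linear_scale (V W : lmodType C) (T : V -> W) : linear T ->
  forall c x, T (c *: x) = c *: T x.
Proof.
by move=> TL c x; have := TL c x 0; rewrite !addr0 (linear_zero TL) addr0.
Qed.

Lemma linear_sub (V W : lmodType C) (T : V -> W) : linear T ->
  forall x y, T (x - y) = T x - T y.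
Proof.
move=> TL x y; rewrite (linear_add TL) -[- y in LHS]scaleN1r (linear_scale TL).
by rewrite scaleN1r.
Qed.

Lemma dense_eq (I : Type) (iota : I -> A) (S T : A -> C) :
  closure (range iota) = setT -> bounded_functional S -> bounded_functional T ->
  (forall i, S (iota i) = T (iota i)) -> S =1 T.
Proof.
move=> dense [SL [M SM]] [TL [N TN]] ST x.
apply/eqP; rewrite -subr_eq0 -normr_eq0 rnormE.
rewrite (_ : rnorm _ = 0)//.
apply/eqP; rewrite eq_le rnorm_ge0 andbT; apply/ler_addgt0Pr => e e0.
(* At distance [r] from [x] the two functionals together contribute at most [(|M| + |N|) * r <= e].
   Absolute values appear because [bounded_functional] puts no sign on its constant. *)
rewrite add0r; pose r := e / (`|M| + `|N| + 1).
have MN0 : 0 < `|M| + `|N| + 1 by rewrite ltr_wpDl// addr_ge0.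
have r0 : 0 < r by rewrite divr_gt0.
have : closure (range iota) x by rewrite dense.
move=> /(_ (ball x (real_complex R r : C))).
have /[swap]/[apply] : nbhs x (ball x (real_complex R r : C)).
  by apply: nbhsx_ballx; rewrite ltcR.
move=> [_ [[i _ <-]]]; rewrite -ball_normE/= rnormE ltcR => xi.
have -> : S x - T x = S (x - iota i) - T (x - iota i).
  by rewrite (linear_sub SL) (linear_sub TL) ST opprB addrA subrK.
rewrite (le_trans (ler_rnormD _ _))// /rnorm normrN -!/(rnorm _).
have bound (K : R) : K * rnorm (x - iota i) <= `|K| * r.
  apply: le_trans (ler_wpM2r (rnorm_ge0 _) (ler_norm K)) _.
  by rewrite ler_wpM2l// ltW.
apply: le_trans (lerD (SM _) (TN _)) _.
apply: le_trans (lerD (bound M) (bound N)) _.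
rewrite -mulrDl /r mulrA ler_pdivrMr// mulrC ler_wpM2l ?(ltW e0)//.
by rewrite lerDl.
Qed.

End banach_algebra.

(** * The correspondence between invariant measures and traces *)

Section traces.
Context (R : realType) (p : R) (p1 : 1 <= p) (G : groupType).
Context (X : ptopologicalType).
Hypothesis compactX : compact [set: X].
Hypothesis metrizableX : metrizable X R.
Variable a : gspace G X.
Context (A : banachAlgType (Cx R)) (iota : Cc R G X -> A).
Hypothesis isA : is_reduced_crossed_product p1 a iota.
Local Notation C := (Cx R).
Local Notation CX := (contfun R X).

Let iotaL := iota_linear isA.
Let iotaE := iotaM isA.
Let dense := iota_dense isA.

Lemma rnorm_iota_single (f : CX) : rnorm (iota (Cc_single f 1%g)) <= supnorm f.
Proof.
by rewrite -lee_fin (iota_isometric isA); exact: reduced_seminorm_single.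
Qed.

(** It lets [bone] compete in the operator norm: [trace_of E mu] takes the value 1 there, so its
    norm is not below 1. *)
Lemma rnorm_bone : rnorm (bone : A) <= 1.
Proof.
rewrite -(iota1 isA) (le_trans (rnorm_iota_single _))//.
apply: supnorm_le => // x; rewrite contfun1E.
by rewrite -(rmorph1 (real_complex R)) rnorm_real normr1.
Qed.

Lemma bounded_functional_mull (tau : A -> C) (y : A) :
  bounded_functional tau -> bounded_functional (fun x => tau (bmul y x)).
Proof.
move=> [tauL [M tauM]]; split.
  by move=> c u v; rewrite bmul_linearr tauL.
exists (`|M| * rnorm y) => x.
apply: (le_trans (tauM _)); apply: le_trans (ler_wpM2r (rnorm_ge0 _) (ler_norm M)) _.
by rewrite -mulrA ler_wpM2l// rnorm_bmul.
Qed.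

Lemma bounded_functional_mulr (tau : A -> C) (y : A) :
  bounded_functional tau -> bounded_functional (fun x => tau (bmul x y)).
Proof.
move=> [tauL [M tauM]]; split.
  by move=> c u v; rewrite bmul_linearl tauL.
exists (`|M| * rnorm y) => x.
apply: (le_trans (tauM _)); apply: le_trans (ler_wpM2r (rnorm_ge0 _) (ler_norm M)) _.
by rewrite -mulrA ler_wpM2l// mulrC rnorm_bmul.
Qed.

(** Commutation under [tau] is bilinear and continuous in each factor. It extends one factor at a
    time, from single terms to finite sums by additivity and then to all of [A] by density, with the
    other factor held fixed. *)
Lemma tracial_single (tau : A -> C) : bounded_functional tau ->
  (forall (f k : CX) g h,
    tau (iota (Cc_mul a (Cc_single f g) (Cc_single k h))) =
    tau (iota (Cc_mul a (Cc_single k h) (Cc_single f g)))) ->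
  forall x y, tau (bmul y x) = tau (bmul x y).
Proof.
move=> btau tau1; have [tauL _] := btau.
have tau2 x (k : CX) h : tau (bmul (iota x) (iota (Cc_single k h))) =
    tau (bmul (iota (Cc_single k h)) (iota x)).
  elim/Cc_ind: x => [x y IHx IHy|f g]; last by rewrite -!iotaE tau1.
  rewrite (linear_add iotaL) bmulDl bmulDr !(linear_add tauL).
  by rewrite IHx IHy.
have tau3 x y : tau (bmul (iota x) (iota y)) = tau (bmul (iota y) (iota x)).
  elim/Cc_ind: y => [y z IHy IHz|f g]; last exact: tau2.
  rewrite (linear_add iotaL) bmulDl bmulDr !(linear_add tauL).
  by rewrite IHy IHz.
have tau4 x y : tau (bmul x (iota y)) = tau (bmul (iota y) x).
  apply: (dense_eq (S := fun x => tau (bmul x (iota y)))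
    (T := fun x => tau (bmul (iota y) x)) dense) => [||i].
  - exact: bounded_functional_mulr.
  - exact: bounded_functional_mull.
  - exact: tau3.
move=> x y.
apply: (dense_eq (S := fun x => tau (bmul y x)) (T := fun x => tau (bmul x y)) dense).
- exact: bounded_functional_mull.
- exact: bounded_functional_mulr.
- by move=> i; rewrite tau4.
Qed.

Section trace_of_measure.
Variable E : A -> CX.
Hypothesis isE : is_standard_expectation iota E.

Lemma trace_of_linear (mu : probability (borel X) R) : linear (trace_of E mu).
Proof.
move=> c x y; rewrite /trace_of (expectation_linear isE).
exact: cintegral_linear.
Qed.

Lemma trace_of_bounded (mu : probability (borel X) R) x :
  rnorm (trace_of E mu x) <= rnorm x.
Proof. exact: le_trans (cintegral_le compactX mu _) (expectation_contractive isE x). Qed.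

Lemma trace_of_single (mu : probability (borel X) R) (f : CX) g :
  trace_of E mu (iota (Cc_single f g)) = if g == 1%g then cintegral mu f else 0.
Proof.
rewrite /trace_of (expectation_iota isE) Cc_singleE eq_sym.
case: ifP => // _; rewrite /cintegral/= !probability_Rintegral_cst.
by [].
Qed.

Lemma cintegral_translate (mu : probability (borel X) R) (f : CX) g :
  invariant_measure a mu -> cintegral mu (translate a g f) = cintegral mu f.
Proof.
move=> muinv; have cf := @contfun_continuous _ _ f.
have inv (h : X -> R) : continuous h ->
    \int[mu]_x h (a g^-1%g x) = \int[mu]_x h x.
  apply: (invariant_Rintegral compactX); first exact: act_continuous.
  exact: muinv.
by rewrite /cintegral; congr Complex; [rewrite -(inv _ (continuous_Re cf))|
  rewrite -(inv _ (continuous_Im cf))].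
Qed.

Lemma trace_of_trace (mu : probability (borel X) R) :
  invariant_measure a mu -> is_normalized_trace (trace_of E mu).
Proof.
move=> muinv; have tL := trace_of_linear mu.
have t1 : trace_of E mu bone = 1.
  by rewrite -(iota1 isA) trace_of_single eqxx cintegral1.
have r1 : rnorm (1 : C) = 1 by rewrite -(rmorph1 (real_complex R)) rnorm_real normr1.
split=> //.
  apply/eqP; rewrite eq_le; apply/andP; split.
    apply: ge_ereal_sup => _ [x /= x1 <-]; apply: le_trans x1.
    by rewrite lee_fin; exact: trace_of_bounded.
  apply: ereal_sup_ubound; exists bone; first by rewrite /= lee_fin rnorm_bone.
  by rewrite t1 r1.
apply: tracial_single.
  by split => //; exists 1 => x; rewrite mul1r; exact: trace_of_bounded.
move=> f k g h; rewrite !Cc_mul_single !trace_of_single.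
(* The two products live at [g * h] and [h * g], so their coefficients at 1 vanish together. *)
have -> : (h * g == 1)%g = (g * h == 1)%g.
  by rewrite !mulg_eq1 eq_sym (can2_eq (@invgK G) (@invgK G)).
case: ifP => // /eqP gh.
have <- : g^-1%g = h by exact: mulg1_eq.
rewrite -(cintegral_translate (k * _) g muinv); congr (cintegral mu _).
apply/funext => x; rewrite contfunME !translateE contfunME !translateE.
by rewrite invgK -actM mulgV act1 mulrC.
Qed.

End trace_of_measure.

Section measure_of_trace.
Hypothesis freeX : free_action a.
Variable tau : A -> C.
Hypothesis tau_trace : is_normalized_trace tau.

Let tauL : linear tau. Proof. by case: tau_trace. Qed.
Let tau1 : tau bone = 1. Proof. by case: tau_trace. Qed.
Let tauC x y : tau (bmul y x) = tau (bmul x y). Proof. by case: tau_trace. Qed.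

Lemma trace_bounded x : rnorm (tau x) <= rnorm x.
Proof.
have [_ _ tn _] := tau_trace.
have := @opnorm_le R A C (fun x => (rnorm x)%:E) (fun z => (rnorm z)%:E) tau 1.
rewrite tn => /(_ (linear_scale tauL)) H; rewrite -lee_fin -[leRHS]mul1e; apply: H => //.
- by move=> c v; rewrite rnormZ EFinM.
- by move=> c v; rewrite -EFinM -rnormM.
- by move=> v; rewrite lee_fin rnorm_ge0.
- by move=> v; rewrite lee_fin rnorm_ge0.
Qed.

Let btau : bounded_functional tau.
Proof. by split => //; exists 1 => x; rewrite mul1r; exact: trace_bounded. Qed.

Let phi (f : CX) g := tau (iota (Cc_single f g)).

Let phiD f k g : phi (f + k) g = phi f g + phi k g.
Proof. by rewrite /phi Cc_singleD (linear_add iotaL) (linear_add tauL). Qed.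

Let phiZ c f g : phi (c *: f) g = c * phi f g.
Proof. by rewrite /phi Cc_singleZ (linear_scale iotaL) (linear_scale tauL). Qed.

Let phiB f k g : phi (f - k) g = phi f g - phi k g.
Proof. by rewrite -scaleN1r phiD phiZ mulN1r. Qed.

Let phiM f g k h : phi (f * translate a g k) (g * h)%g =
  phi (k * translate a h f) (h * g)%g.
Proof. by rewrite /phi -!Cc_mul_single !iotaE tauC. Qed.

Lemma trace_translate (f : CX) g : phi (translate a g f) 1%g = phi f 1%g.
Proof.
(* The factors are [u_g f] and [u_g^-1]: in one order their product is [translate a g f], in the
   other it is [f]. *)
have := phiM (translate a g f) g 1 g^-1%g.
rewrite translate_1 mulr1 mulgV mulVg mul1r translateM mulVg translate1.
by [].
Qed.

(* The [m] for which [f * m * u_g] has trace 0 for all [f] form an ideal, which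
   contains every [k - translate g k] since [k * (f * u_g)] and [(f * u_g) * k]
   have the same trace. By freeness these have no common zero, so that the
   ideal is all of [C(X)]. *)
Lemma trace_off_diagonal (f : CX) g : g <> 1%g -> phi f g = 0.
Proof.
move=> g1; pose J (m : CX) := forall f, phi (f * m) g = 0.
have J_sub k : J (k - translate a g k).
  move=> u; rewrite mulrBr phiB; have := phiM u g k 1%g.
  by rewrite translate1 mulg1 mul1g => ->; rewrite [k * u]mulrC subrr.
have JM m n : J m -> J (n * m) by move=> Jm u; rewrite mulrA Jm.
have JD m n : J m -> J n -> J (m + n).
  by move=> Jm Jn u; rewrite mulrDr phiD Jm Jn addr0.
have J0 : J 0.
  by move=> u; rewrite mulr0 -(scale0r 0) phiZ mul0r.
(* The square of [k - translate a g k] is used because it is nonnegative: in a finite sum of such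
   functions nothing cancels, so the sum is positive wherever one term is. *)
have sep x : exists q : X -> R,
    [/\ continuous q, forall y, 0 <= q y, 0 < q x & J (rcont q)].
  have xg : x <> a g^-1%g x.
    by move=> /esym /freeX; rewrite -[RHS]invg1 => /invg_inj.
  have [k ck kx] := metrizable_separates metrizableX xg.
  have ckg : continuous (fun y => k (a g^-1%g y)).
    by move=> y; apply: continuous_comp; [exact: act_continuous|exact: ck].
  have cq : continuous (fun y => (k y - k (a g^-1%g y)) * (k y - k (a g^-1%g y))).
    by move=> y; apply: cvgM; apply: cvgB; (try exact: ck); exact: ckg.
  exists (fun y => (k y - k (a g^-1%g y)) * (k y - k (a g^-1%g y))); split => //.
  - by move=> y; rewrite -expr2 sqr_ge0.
  - rewrite -expr2 lt_def sqr_ge0 andbT sqrf_eq0 subr_eq0.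
    exact/eqP.
  - pose m : CX := rcont k - translate a g (rcont k).
    have -> : rcont (fun y => (k y - k (a g^-1%g y)) * (k y - k (a g^-1%g y))) = m * m.
      apply: contfun_eqP => y; rewrite (rcontE y cq) contfunME.
      have -> : m y = real_complex R (k y - k (a g^-1%g y)).
        rewrite contfunDE contfunNE translateE.
        by rewrite [X in X + _](rcontE y ck) [X in - X](rcontE _ ck) rmorphB.
      by rewrite rmorphM.
    exact/JM/J_sub.
have [q qP] := choice sep.
have : cover_compact [set: X] by rewrite -compact_cover.
move=> /(_ X setT (fun x => [set y | 0 < q x y]))[x _|x _|D _ DX].
- rewrite (_ : [set y | _] = q x @^-1` [set r | 0 < r])//.
  by apply: open_comp; [move=> y _; have [cq _ _ _] := qP x; exact: cq|exact: open_gt].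
- by exists x => //=; have [_ _ + _] := qP x.
pose S y := \sum_(x <- finmap.enum_fset D) q x y.
have SP (s : seq X) : continuous (fun y => \sum_(x <- s) q x y) /\
    J (rcont (fun y => \sum_(x <- s) q x y)).
  elim: s => [|x s [cs Js]].
    have -> : (fun y => \sum_(x <- [::]) q x y) = cst 0.
      by apply/funext => y; rewrite big_nil.
    have c0 : continuous (cst 0 : X -> R) by move=> y; exact: cvg_cst.
    split=> //; have -> : rcont (cst 0 : X -> R) = 0 :> CX; last exact: J0.
    by apply: contfun_eqP => y; rewrite (rcontE y c0).
  have [cq _ _ Jq] := qP x.
  have -> : (fun y => \sum_(z <- x :: s) q z y) =
      (fun y => q x y + \sum_(z <- s) q z y).
    by apply/funext => y; rewrite big_cons.
  split; last by rewrite (rcontD cq cs); exact: JD.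
  by move=> y; apply: cvgD; [exact: cq|exact: cs].
have [cS JS] := SP (finmap.enum_fset D).
have S0 y : S y != 0.
  have [x xD qxy] := DX y I; rewrite gt_eqF// /S.
  rewrite (big_rem x)//= ltr_wpDr// sumr_ge0// => z _.
  by have [_ + _ _] := qP z.
have cV : continuous (fun y => (S y)^-1).
  by move=> y; apply: cvgV => //; exact: cS.
(* The finite sum [S] lies in the ideal and vanishes nowhere, so it is invertible in C(X). *)
have J1 : J 1.
  have -> : 1 = rcont (fun y => (S y)^-1) * rcont S.
    apply: contfun_eqP => y; rewrite contfunME.
    rewrite [X in _ = X * _](rcontE y cV) [X in _ = _ * X](rcontE y cS).
    by rewrite -rmorphM mulVf.
  exact: JM.
by rewrite -[f]mulr1.
Qed.

Lemma trace_measure : exists mu : probability (borel X) R,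
  invariant_measure a mu /\ (forall f : CX, phi f 1%g = cintegral mu f).
Proof.
have [|||mu muE] := complex_riesz compactX metrizableX (phi := phi^~ 1%g).
- by move=> c f k; rewrite phiD phiZ.
- by rewrite /phi (iota1 isA).
- by move=> f; apply: (le_trans (trace_bounded _)); exact: rnorm_iota_single.
exists mu; split=> // g; apply: Rintegral_invariant => //.
  exact: act_continuous.
move=> h ch; have chg : continuous (fun x => h (a g x)).
  by move=> y; apply: continuous_comp; [exact: act_continuous|exact: ch].
have : real_complex R (\int[mu]_x h (a g x)) = real_complex R (\int[mu]_x h x).
  rewrite -(cintegral_rcont mu ch) -(cintegral_rcont mu chg) -!muE.
  (* The inverse appears because translation by [g] composes with the action of [g^-1]. *)
  rewrite -[RHS](trace_translate _ g^-1%g); congr (phi _ _).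
  apply: contfun_eqP => x; rewrite translateE invgK (rcontE x chg).
  by rewrite [RHS](rcontE _ ch).
by case.
Qed.

(** Both functionals are bounded, so single terms decide. At [g = 1] they agree by the choice of
    [mu]; elsewhere [E] kills the term, and freeness makes [tau] vanish on it. *)
Lemma trace_of_eq (E : A -> CX) (mu : probability (borel X) R) :
  is_standard_expectation iota E ->
  (forall f : CX, phi f 1%g = cintegral mu f) -> trace_of E mu = tau.
Proof.
move=> isE muE; apply/funext.
apply: (dense_eq dense) => //.
  split; first exact: trace_of_linear.
  by exists 1 => x; rewrite mul1r; exact: trace_of_bounded.
elim/Cc_ind => [x y IHx IHy|f g].
  rewrite (linear_add iotaL) (linear_add tauL) (linear_add (trace_of_linear isE mu)).
  by rewrite IHx IHy.
rewrite (trace_of_single isE); case: eqP => [->|g1]; first by rewrite -muE.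
by apply/esym; exact: trace_off_diagonal.
Qed.

End measure_of_trace.
End traces.

Theorem theorem5p9 (R : realType) (p : R) (p1 : 1 <= p)
  (G : groupType) (countableG : countable [set: G])
  (X : ptopologicalType) (compactX : compact [set: X])
  (metrizableX : metrizable X R)
  (a : gspace G X) (freeX : free_action a)
  (A : banachAlgType (Cx R)) (iota : Cc R G X -> A)
  (isA : is_reduced_crossed_product p1 a iota)
  (E : A -> contfun R X) (isE : is_standard_expectation iota E) :
  [/\ (* mu |-> tau_mu maps invariant measures to normalized traces *)
      forall mu : probability (borel X) R,
        invariant_measure a mu -> is_normalized_trace (trace_of E mu),
      (* affine *)
      forall (t : R) (t01 : 0 <= t <= 1) (mu nu : probability (borel X) R),
        invariant_measure a mu -> invariant_measure a nu ->
        invariant_measure a (prob_conv t01 mu nu) /\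
        forall x, trace_of E (prob_conv t01 mu nu) x =
          real_complex R t * trace_of E mu x +
          real_complex R (1 - t) * trace_of E nu x,
      (* well defined and injective *)
      forall mu nu : probability (borel X) R,
        invariant_measure a mu -> invariant_measure a nu ->
        (borel_eq mu nu <-> trace_of E mu = trace_of E nu) &
      (* surjective, with the Riesz measure of the restriction to C(X) as
         preimage *)
      forall tau : A -> Cx R, is_normalized_trace tau ->
        exists mu : probability (borel X) R,
          [/\ invariant_measure a mu, trace_of E mu = tau &
              riesz_measure (fun f => tau (iota (Cc_single f 1%g))) mu]].
Proof.
(* On C(X) the functional of [mu] is integration against [mu]. Injectivity and the Riesz claim both
   read the measure off from there. *)
have single mu (f : contfun R X) :
    trace_of E mu (iota (Cc_single f 1%g)) = cintegral mu f.
  by rewrite /trace_of (expectation_iota isE) Cc_singleE eqxx.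
split.
- by move=> mu; exact: (trace_of_trace compactX isA isE).
- move=> t t01 mu nu muinv nuinv; split.
    by move=> g B mB; rewrite /= !prob_convE muinv// nuinv.
  move=> x; rewrite /trace_of /cintegral !real_complexM.
  have cf := @contfun_continuous _ _ (E x).
  rewrite (prob_conv_Rintegral compactX t01 mu nu (continuous_Re cf)).
  by rewrite (prob_conv_Rintegral compactX t01 mu nu (continuous_Im cf)).
- move=> mu nu _ _; split=> [munu|tr].
    apply/funext => x; rewrite /trace_of /cintegral.
    by congr Complex; exact: borel_eq_Rintegral.
  apply: finite_measure_unique => // f cf.
  have := single mu (rcont f); rewrite tr single.
  by rewrite (cintegral_rcont _ cf) (cintegral_rcont _ cf) => -[].
- move=> tau tau_trace.
  have [mu [muinv muE]] := trace_measure compactX metrizableX isA tau_trace.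
  exists mu; split => //.
    exact: (trace_of_eq compactX metrizableX isA freeX tau_trace isE).
  split=> // nu nuE; apply: finite_measure_unique => // f cf.
  have := nuE (rcont f); rewrite muE.
  by rewrite (cintegral_rcont _ cf) (cintegral_rcont _ cf) => -[].
Qed.
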